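(* Let $K$ be a field and let $\Delta$ be a simplicial complex on the vertex set $[n]$ such that $R=R_\Delta$ is normal. Then the divisor class group $\operatorname{Cl}(R)$ is free of rank $r-1$, where $r$ is the number of minimal prime ideals of $(t)$ in $R$ (which is also the number of facets of the cone $\mathbb{R}_+S$ which do not contain the lattice point $e_{n+1}$).
   Context: $[n]=\{1,\ldots,n\}$. A simplicial complex $\Delta$ on $[n]$ is a family of subsets of $[n]$ closed under taking subsets and containing all $\{i\}$, $i\in[n]$. For $F\subseteq [n]$ put $x_F=\prod_{i\in F}x_i$ (with $x_\emptyset=1$). The toric ring of $\Delta$ is the subalgebra $R_\Delta=K[x_Ft : F\in\Delta]$ of the polynomial ring $K[x_1,\ldots,x_n,t]$; here $t\in R_\Delta$ is the generator corresponding to the empty face. Let $e_1,\ldots,e_{n+1}$ be the standard basis of $\mathbb{Z}^{n+1}$. $S\subset\mathbb{Z}^{n+1}$ is the affine semigroup generated by the lattice points $p_F=\sum_{i\in F}e_i+e_{n+1}$, $F\in\Delta$, and $\mathbb{R}_+S\subset\mathbb{R}^{n+1}$ is the smallest cone containing $S$. *)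

(* Defs.v *)
From HB Require Import structures.
From mathcomp Require Import all_boot all_order all_algebra.
From mathcomp Require Import boolp classical_sets functions cardinality reals.
From mathcomp Require Import generic_quotient ring_quotient fraction mxpoly.
From mathcomp Require Import mpoly freeg.

Set Implicit Arguments.
Unset Strict Implicit.
Unset Printing Implicit Defensive.

Import GRing.Theory Num.Theory.

Local Open Scope classical_set_scope.
Local Open Scope ring_scope.

Definition is_ideal (R : comNzRingType) (I : set R) : Prop :=
  0 \in I /\ forall a : R, {in I &, forall u v, a * u + v \in I}.

Definition principal_ideal (R : comNzRingType) (x : R) : set R :=
  [set a * x | a in [set: R]].

Definition ideal_power (R : comNzRingType) (I : set R) (k : nat) : set R :=
  smallest (@is_ideal R)
    [set \prod_(i < k) a i | a in [set a : 'I_k -> R | forall i, I (a i)]].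

(* [idealr_closed] includes properness. *)
Definition prime_ideal (R : comNzRingType) (P : set R) : Prop :=
  idealr_closed (mem P) /\ prime_idealr_closed (mem P).

Definition minimal_primes (R : comNzRingType) (I : set R) : set (set R) :=
  [set P | [/\ prime_ideal P, I `<=` P &
    forall Q, prime_ideal Q -> I `<=` Q -> Q `<=` P -> Q = P]].

Definition normal_domain (R : idomainType) : Prop :=
  forall x : {fraction R}, integralOver (@tofrac R) x ->
    exists r : R, x = tofrac r.

Definition height_one_prime (R : idomainType) (P : set R) : Prop :=
  [/\ prime_ideal P, P != [set 0] &
    forall Q, prime_ideal Q -> Q `<=` P -> Q = [set 0] \/ Q = P].

Definition height_one (R : idomainType) : Type :=
  {P : set R | `[< height_one_prime P >]}.

(* The contraction to R of the k-th power of the maximal ideal of R_P. *)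
Definition symbolic_power (R : comNzRingType) (P : set R) (k : nat) : set R :=
  [set f | exists2 s, ~ P s & ideal_power P k (s * f)].

(* The valuation of the discrete valuation ring R_P takes the value k at f. *)
Definition has_order (R : comNzRingType) (P : set R) (f : R) (k : nat) : Prop :=
  symbolic_power P k f /\ ~ symbolic_power P k.+1 f.

Definition divisor (R : idomainType) := {freeg (height_one R) / int}.

Definition is_div (R : idomainType) (f : R) (D : divisor R) : Prop :=
  forall P : height_one R,
    exists2 k : nat, has_order (val P) f k & coeff P D = k%:Z.

(* As div (f / g) = div f - div g, the subgroup generated by the divisors of *)
(* the nonzero elements of R consists of the divisors of the nonzero         *)
(* elements of the fraction field.                                           *)
Definition principal_divisors (R : idomainType) : set (divisor R) :=
  smallest (fun G : set (divisor R) => zmod_closed (mem G))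
    [set D | exists2 f : R, f != 0 & is_div f D].

Definition principal_pred (R : idomainType) : {pred divisor R} :=
  [pred D | `[< principal_divisors D >]].

Fact principal_pred_zmod (R : idomainType) : zmod_closed (@principal_pred R).
Proof.
split=> [|x y /asboolP xP /asboolP yP]; apply/asboolP => A AP; case: (AP) => -[c0 cB] _.
  exact: set_mem c0.
apply: set_mem; apply: cB; apply: mem_set; [exact: xP A AP | exact: yP A AP].
Qed.

HB.instance Definition _ (R : idomainType) :=
  GRing.isZmodClosed.Build (divisor R) (@principal_pred R)
    (@principal_pred_zmod R).

Definition class_group (R : idomainType) : zmodType :=
  {ideal_quot (@principal_pred R : zmodClosed (divisor R))}.

Definition free_of_rank (G : zmodType) (m : nat) : Prop :=
  exists f : {additive G -> 'rV[int]_m}, bijective f.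

Record simplicial_complex (n : nat) := SimplicialComplex {
  faces :> {set {set 'I_n}};
  face0 : finset.set0 \in faces;
  face1 : forall i : 'I_n, [set i]%SET \in faces;
  face_sub : forall F G : {set 'I_n}, F \in faces -> G \subset F -> G \in faces
}.

Section ToricRing.
Variables (K : fieldType) (n : nat) (Delta : simplicial_complex n).

Let x (i : 'I_n) : {mpoly K[n.+1]} := 'X_(widen_ord (leqnSn n) i).
Let t : {mpoly K[n.+1]} := 'X_ord_max.

Definition toric_gen (F : {set 'I_n}) : {mpoly K[n.+1]} :=
  (\prod_(i in F) x i) * t.

Definition toric_pred : {pred {mpoly K[n.+1]}} :=
  [pred p | `[< smallest (fun A : set {mpoly K[n.+1]} => subalg_closed (mem A))
    [set toric_gen F | F in [set` Delta]] p >]].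

Fact toric_pred_subalg : subalg_closed toric_pred.
Proof.
split=> [|a u v /asboolP uP /asboolP vP|u v /asboolP uP /asboolP vP];
  apply/asboolP => A AP; case: (AP) => -[c1 cZ cM] _; apply: set_mem.
- exact: c1.
- by apply: cZ; apply: mem_set; [exact: uP A AP | exact: vP A AP].
- by apply: cM; apply: mem_set; [exact: uP A AP | exact: vP A AP].
Qed.

HB.instance Definition _ :=
  GRing.isSubringClosed.Build _ toric_pred
    (GRing.subalg_closedBM toric_pred_subalg).

Record toric_ring := ToricElt {
  toric_val :> {mpoly K[n.+1]};
  _ : toric_val \in toric_pred
}.

HB.instance Definition _ := [isSub for toric_val].
HB.instance Definition _ := [Choice of toric_ring by <:].
HB.instance Definition _ := [SubChoice_isSubComNzRing of toric_ring by <:].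

(* The instance of [idomainType] requires a total inverse. *)
Definition toric_unit : pred toric_ring :=
  [pred u | `[< exists v : toric_ring, v * u = 1 >]].

Definition toric_inv (u : toric_ring) : toric_ring :=
  if pselect (exists v : toric_ring, v * u = 1) is left h then projT1 (cid h)
  else u.

Fact toric_mulVx : {in toric_unit, left_inverse 1 toric_inv *%R}.
Proof.
move=> u /asboolP h; rewrite /toric_inv; case: pselect => // h'.
exact: (projT2 (cid h')).
Qed.

Fact toric_unitPl (u v : toric_ring) : v * u = 1 -> toric_unit u.
Proof. by move=> h; apply/asboolP; exists v. Qed.

Fact toric_invr_out : {in [predC toric_unit], toric_inv =1 id}.
Proof.
move=> u /negP h; rewrite /toric_inv; case: pselect => // h'.
by case: h; apply/asboolP.
Qed.

HB.instance Definition _ :=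
  GRing.ComNzRing_hasMulInverse.Build toric_ring
    toric_mulVx toric_unitPl toric_invr_out.

Fact toric_mulf_eq0 (u v : toric_ring) : u * v = 0 -> (u == 0) || (v == 0).
Proof.
move=> /(congr1 val) /eqP; rewrite rmorphM rmorph0 mulf_eq0 => h.
by rewrite -!(inj_eq val_inj) rmorph0.
Qed.

HB.instance Definition _ :=
  GRing.ComUnitRing_isIntegral.Build toric_ring toric_mulf_eq0.

Fact toric_t_subproof : t \in toric_pred.
Proof.
apply/asboolP => A [_]; apply; exists finset.set0; first exact: face0.
by rewrite /toric_gen big_set0 mul1r.
Qed.

Definition toric_t : toric_ring := ToricElt toric_t_subproof.

End ToricRing.

Section ToricCone.
Variables (n : nat) (Delta : simplicial_complex n).

Definition lattice_point (F : {set 'I_n}) : 'rV[int]_n.+1 :=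
  (\sum_(i in F) delta_mx 0 (widen_ord (leqnSn n) i)) + delta_mx 0 ord_max.

Definition toric_semigroup : set 'rV[int]_n.+1 :=
  smallest (fun A : set 'rV[int]_n.+1 => addr_closed (mem A))
    [set lattice_point F | F in [set` Delta]].

End ToricCone.

Section Cones.
Variables (R : realType) (m : nat).

Definition dotr (a y : 'rV[R]_m) : R := \sum_i a 0 i * y 0 i.

Definition convex_cone (C : set 'rV[R]_m) : Prop :=
  addr_closed (mem C) /\
  forall c y, 0 <= c -> C y -> C (c *: y).

Definition cone_over (S : set 'rV[int]_m) : set 'rV[R]_m :=
  smallest convex_cone [set map_mx intr p | p in S].

Definition face (C F : set 'rV[R]_m) : Prop :=
  exists2 a : 'rV[R]_m, (forall y, C y -> 0 <= dotr a y) &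
    F = C `&` [set y | dotr a y = 0].

(* The linear span of X has dimension d: the rows of A form a basis of it. *)
Definition has_dim (X : set 'rV[R]_m) (d : nat) : Prop :=
  exists A : 'M[R]_(d, m),
    [/\ row_free A, forall i, X (row i A) & forall y, X y -> (y <= A)%MS].

Definition facet (C F : set 'rV[R]_m) : Prop :=
  face C F /\ exists2 d : nat, has_dim C d.+1 & has_dim F d.

End Cones.

Arguments cone_over R {m} S.

(* Main.v *)
From HB Require Import structures.
Require Import Defs.
From mathcomp Require Import all_boot all_order all_algebra.
From mathcomp Require Import boolp classical_sets functions cardinality reals.
From mathcomp Require Import generic_quotient ring_quotient fraction mxpoly.
From mathcomp Require Import mpoly freeg.
From mathcomp Require Import ring zify.

Set Implicit Arguments.
Unset Strict Implicit.
Unset Printing Implicit Defensive.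

Import Order.TTheory GRing.Theory Num.Theory.
Local Open Scope ring_scope.

(** Let [S] be the monoid generated by the lattice points [p_F], and write
    [x^u] for the monomial with exponents [u]; the toric ring [R] has the [x^u]
    with [u] in [S] as a basis. Inverting [t = x^(e_(n+1))] in [R] gives the
    ring [K[x_1, ..., x_n, t, 1 / t]], as [x_i = (x_i t) / t]. The latter is
    factorial, so the argument of Nagata applies: the class group of [R] is
    generated by the height one primes that contain [t], and the relations
    between these come from the units of the localization, that is, from
    [div t] alone.

    The primes containing [t] are found on the polyhedral side. Normality of
    [R] makes [S] saturated ([normal_saturated]), and then Farkas' lemma
    identifies [S] with the set of lattice points on the nonnegative side of
    all facets of the cone ([saturated_facets]). The facets through [e_(n+1)]
    are the [n] coordinate hyperplanes; let [L_1, ..., L_r] be the primitive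
    integral forms that define the others. The least value of [L_j] on the
    exponents of a polynomial is a discrete valuation, nonnegative on [R], and
    its centre [Q_j] is a height one prime containing [t]. Every prime
    containing [t] contains some [Q_j] ([prime_contains_facet]), so that the
    [Q_j] are the minimal primes of [(t)] and also the height one primes
    containing [t]. The other height one primes are the contractions of the
    principal primes of the polynomial ring ([height_one_contraction]), by
    unique factorization ([factorial_mpoly]).

    Consequently the class group is the quotient of [Z^r] by the vector
    [(c_1, ..., c_r)], where [c_j = L_j(e_(n+1))] is the order of [t] along
    [Q_j] ([class_vector_principal], [principal_class_vector]). It is free of
    rank [r - 1] because some [c_j] equals 1: if [C] is a maximal set of
    vertices no two of which are joined by an edge, then each face meets [C] at
    most once, and [x_(n+1) - \sum_(i in C) x_i] defines a facet
    ([unit_facet_form]). *)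

(** * Unique factorization in polynomial rings *)

Section Divisibility.
Variable D : idomainType.
Implicit Types a b c p q : D.

Definition divides a b : Prop := exists c, b = c * a.

Definition prime_elt p : Prop :=
  [/\ p != 0, p \isn't a GRing.unit &
    forall a b, divides p (a * b) -> divides p a \/ divides p b].

Lemma dividesD p a b : divides p a -> divides p b -> divides p (a + b).
Proof. by move=> [c ->] [d ->]; exists (c + d); rewrite mulrDl. Qed.

Lemma dividesB p a b : divides p a -> divides p b -> divides p (a - b).
Proof. by move=> [c ->] [d ->]; exists (c - d); rewrite mulrBl. Qed.

Lemma divides_mull p a b : divides p b -> divides p (a * b).
Proof. by move=> [c ->]; exists (a * c); rewrite mulrA. Qed.

Lemma divides_mulr p a b : divides p a -> divides p (a * b).
Proof. by rewrite mulrC; apply: divides_mull. Qed.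

Lemma divides_trans a b c : divides a b -> divides b c -> divides a c.
Proof. by move=> [d ->] [e ->]; exists (e * d); rewrite mulrA. Qed.

Lemma divides_refl a : divides a a.
Proof. by exists 1; rewrite mul1r. Qed.

Lemma prime_neq0 p : prime_elt p -> p != 0. Proof. by case. Qed.

Lemma prime_not_dvd_unit p u : prime_elt p -> u \is a GRing.unit ->
  ~ divides p u.
Proof.
case=> _ pU _ uU [c ucp]; move: uU; rewrite ucp unitrM => /andP[_ pU'].
by rewrite pU' in pU.
Qed.

Lemma prime_dvd_prod p (s : seq D) : prime_elt p ->
  divides p (\prod_(q <- s) q) -> exists2 q, q \in s & divides p q.
Proof.
move=> pP; elim: s => [|q s IHs].
  by rewrite big_nil => /(prime_not_dvd_unit pP (unitr1 _)).
rewrite big_cons => pqs; case: pP (pP) => _ _ /(_ _ _ pqs) [pq|ps] pP.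
  by exists q; rewrite ?mem_head.
by have [q' q's pq'] := IHs ps; exists q' => //; rewrite inE q's orbT.
Qed.

Lemma prime_dvd_prime p q : prime_elt p -> prime_elt q -> divides p q ->
  exists2 u, u \is a GRing.unit & q = u * p.
Proof.
move=> pP [q0 _ qP] [c qcp]; exists c => //.
have [|[d cdq]|[d pdq]] := qP c p; first by exists 1; rewrite mul1r qcp.
  case: (prime_not_dvd_unit pP (unitr1 _)); exists d.
  by apply: (mulIf q0); rewrite mul1r mulrAC -cdq.
apply/unitrPr; exists d; apply: (mulIf q0).
by rewrite mul1r -mulrA -pdq.
Qed.

Definition factorial_ring : Prop := forall a, a != 0 ->
  exists u (s : seq D), [/\ u \is a GRing.unit,
    forall p, p \in s -> prime_elt p & a = u * \prod_(p <- s) p].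

Lemma prime_pow_cancel q a b k : prime_elt q -> ~ divides q a ->
  divides (q ^+ k) (a * b) -> divides (q ^+ k) b.
Proof.
move=> [q0 _ qP] qa; elim: k b => [|k IHk] b; first by exists b; rewrite mulr1.
rewrite exprSr => -[c abc].
have [|//|[d bdq]] := qP a b; first by exists (c * q ^+ k); rewrite -mulrA.
have [|e de] := IHk d.
  by exists c; apply: (mulIf q0); rewrite -!mulrA -bdq.
by exists e; rewrite bdq de mulrA.
Qed.

End Divisibility.

Section Transport.
Variables (A B : idomainType) (f : {rmorphism A -> B}) (g : B -> A).
Hypotheses (fK : cancel f g) (gK : cancel g f).

Let gM : {morph g : x y / x * y}.
Proof. by move=> x y; apply: (can_inj fK); rewrite rmorphM !gK. Qed.

Lemma unit_transport x : x \is a GRing.unit -> g x \is a GRing.unit.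
Proof.
move=> xU; apply/unitrPr; exists (g x^-1); rewrite -gM divrr //.
by apply: (can_inj fK); rewrite gK rmorph1.
Qed.

Lemma divides_transport p x : divides (g p) x <-> divides p (f x).
Proof.
split=> -[c e]; first by exists (f c); rewrite e rmorphM gK.
by exists (g c); rewrite -gM -e fK.
Qed.

Lemma prime_transport p : prime_elt p -> prime_elt (g p).
Proof.
case=> p0 pU pP; split.
- by apply: contraNneq p0 => gp0; rewrite -[p]gK gp0 rmorph0.
- by apply: contra pU => /(rmorph_unit f); rewrite gK.
by move=> a b /divides_transport; rewrite rmorphM => /pP[] h; [left|right];
   apply/divides_transport.
Qed.

Lemma factorial_transport : factorial_ring B -> factorial_ring A.
Proof.
move=> facB a a0; have [|u [s [uU sP fa]]] := facB (f a).
  by rewrite -(rmorph0 f) (inj_eq (can_inj fK)).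
exists (g u), [seq g p | p <- s]; split; first exact: unit_transport.
  by move=> _ /mapP[p ps ->]; apply/prime_transport/sP.
apply: (can_inj fK); rewrite fa rmorphM gK big_map rmorph_prod; congr (_ * _).
by apply: eq_bigr => i _; rewrite gK.
Qed.

End Transport.

Section Gauss.
Variable D : idomainType.
Implicit Types (p : D) (f g h : {poly D}).

Lemma divides_polyC p f : divides p%:P f <-> forall i, divides p f`_i.
Proof.
split=> [[g ->] i|h]; first by rewrite coefMC; exists g`_i.
exists (\poly_(i < size f) projT1 (cid (h i))); apply/polyP => i.
rewrite coefMC coef_poly; case: ltnP => [_|le];
  first exact: (projT2 (cid (h i))).
by rewrite mul0r nth_default.
Qed.

Lemma divides_polyC_MX p f : divides p%:P (f * 'X) -> divides p%:P f.
Proof.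
by move=> /divides_polyC h; apply/divides_polyC => i; have := h i.+1;
  rewrite coefMX.
Qed.

Lemma divides_polyCC p c : divides p c -> divides p%:P c%:P.
Proof. by move=> [d ->]; exists d%:P; rewrite polyCM. Qed.

(** [p] divides the constant coefficient of the product, hence that of one of
    the factors, which can then be dropped from this factor. *)
Lemma prime_polyC p : prime_elt p -> prime_elt p%:P.
Proof.
case=> p0 pU pP; split; first by rewrite polyC_eq0.
  by rewrite poly_unitE size_polyC p0 coefC eqxx (negPf pU).
elim/poly_ind => [|a c IHa] b; first by left; exists 0; rewrite mul0r.
have [pc|npc] := pselect (divides p c).
  rewrite mulrDl => pab.
  have /divides_polyC_MX/IHa[pa|] : divides p%:P (a * b * 'X).
  - rewrite mulrAC; have := dividesB pab (divides_mulr b (divides_polyCC pc)).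
    by rewrite addrK.
  - by left; apply: dividesD (divides_polyCC pc); exact: divides_mulr.
  by right.
elim/poly_ind: b => [|b d IHb]; first by right; exists 0; rewrite mul0r.
move=> pab; have /pP[//|pd] : divides p (c * d).
  move/divides_polyC/(_ 0%N): pab.
  by rewrite coef0M !coefD !coefMX !coefC /= !add0r.
have /divides_polyC_MX/IHb[pa|pb] : divides p%:P ((a * 'X + c%:P) * b * 'X).
- have := dividesB pab (divides_mull (a * 'X + c%:P) (divides_polyCC pd)).
  by rewrite mulrDr addrK mulrA.
- by left.
by right; apply: dividesD (divides_polyCC pd); exact: divides_mulr.
Qed.

Hypothesis facD : factorial_ring D.

Definition primitive_poly f : Prop :=
  forall p, prime_elt p -> ~ divides p%:P f.

(** Divide by primes as long as possible; each of them uses up a prime factor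
    of the leading coefficient. *)
Lemma primitive_part f : f != 0 ->
  exists c g, [/\ c != 0, primitive_poly g & f = c%:P * g].
Proof.
move=> f0; have [|u [s [uU sP lf]]] := facD (a := lead_coef f).
  by rewrite lead_coef_eq0.
have [k] := ubnP (size s).
elim: k => // k IHk in f f0 u s uU sP lf *; rewrite ltnS => sk.
have [fprim|/existsNP[p /not_implyP[pP /contrapT [g fg]]]] :=
    pselect (primitive_poly f).
  by exists 1, f; rewrite oner_eq0 mul1r.
have g0 : g != 0 by apply: contraNneq f0 => g0; rewrite fg g0 mul0r.
have lfg : lead_coef f = lead_coef g * p.
  by rewrite fg lead_coefM lead_coefC.
have [v vs pv] : exists2 q, q \in s & divides p q.
  apply: prime_dvd_prod => //; exists (u^-1 * lead_coef g).
  by rewrite -mulrA -lfg lf mulKr.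
have [w wU vw] := prime_dvd_prime pP (sP _ vs) pv.
have [||||c' [h [c0 hP gh]]] := IHk g g0 (u * w) (rem v s).
- by rewrite unitrM uU.
- by move=> q /mem_rem /sP.
- apply: (mulIf (prime_neq0 pP)); rewrite -lfg lf (big_rem _ vs) /= vw.
  by rewrite -!mulrA; congr (_ * (_ * _)); rewrite mulrC.
- by rewrite size_rem // (leq_trans _ sk) // prednK //; case: (s) vs.
exists (c' * p), h; split=> //; first by rewrite mulf_neq0 ?(prime_neq0 pP).
by rewrite fg gh polyCM mulrAC.
Qed.

(** The prime factors of [d] can be cancelled one at a time: they are prime in
    [{poly D}] and do not divide [f], so they divide the cofactor of [f]. *)
Lemma primitive_cancel d f g : d != 0 -> primitive_poly f ->
  divides f (d%:P * g) -> divides f g.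
Proof.
move=> /facD[u [s [uU sP ->]]] fP; elim: s sP => [_|p s IHs sP].
  rewrite big_nil mulr1 => -[h e]; exists (u^-1%:P * h).
  by rewrite -mulrA -e mulrA -polyCM mulVr // mul1r.
rewrite big_cons mulrCA polyCM -mulrA => -[h e].
have pP : prime_elt p by apply: sP; rewrite mem_head.
have [_ _ /(_ h f)] := prime_polyC pP.
case=> [|[k hk]|/(fP _ pP) //]; first by eexists; rewrite -e mulrC.
apply: IHs => [q qs|]; first by apply: sP; rewrite inE qs orbT.
exists k; apply: (mulfI (x := p%:P)); first by rewrite polyC_eq0 prime_neq0.
by rewrite e hk mulrAC mulrC.
Qed.

(** Each prime factor of [d] divides [g] or [h] and is cancelled there, so that
    a factorization of [f] over the fraction field descends to [D]. *)
Lemma primitive_split d f g h : d != 0 -> primitive_poly f ->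
  d%:P * f = g * h ->
  exists g' h', [/\ size g' = size g, size h' = size h & f = g' * h'].
Proof.
move=> /facD[u [s [uU sP ->]]] fP; elim: s sP g h => [_|p s IHs sP] g h.
  rewrite big_nil mulr1 => e; exists (u^-1 *: g), h.
  have u0 : u^-1 != 0 by rewrite invr_eq0; apply: contraTneq uU => ->;
    rewrite unitr0.
  rewrite size_scale //; split=> //.
  by rewrite -scalerAl -e -mul_polyC mulrA -polyCM mulVr // mul1r.
have pP : prime_elt p by apply: sP; rewrite mem_head.
have p0 : p%:P != 0 by rewrite polyC_eq0 prime_neq0.
rewrite big_cons mulrCA polyCM -mulrA => e.
have IH := IHs (fun q qs => sP q (mem_behead (s := p :: s) qs)).
have szp k : size (k * p%:P) = size k.
  by rewrite mulrC mul_polyC size_scale // prime_neq0.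
have [_ _ /(_ g h)] := prime_polyC pP.
case=> [|[k gk]|[k hk]]; first by rewrite -e;
  exists ((u * \prod_(j <- s) j)%:P * f); rewrite mulrC.
  rewrite gk szp; apply: IH; apply: (mulfI p0); rewrite e gk.
  by rewrite mulrAC mulrC.
rewrite hk szp; apply: IH; apply: (mulfI p0); rewrite e hk.
by rewrite mulrA mulrC.
Qed.

Lemma primitive_factor f g h : primitive_poly f -> f = g * h ->
  primitive_poly g /\ primitive_poly h.
Proof.
move=> fP fgh; split=> p pP hp; apply: (fP p pP); rewrite fgh.
  exact: divides_mulr.
exact: divides_mull.
Qed.

(** By [primitive_split], [f] does not split over the fraction field either, so
    it is prime there, and [primitive_cancel] brings the divisibilities back to
    [D]. Divisibility over the fraction field is the pseudo-divisibility [%|].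
      *)
Lemma primitive_unsplit_prime f : (1 < size f)%N -> primitive_poly f ->
  (forall g h, f = g * h -> (size g <= 1)%N \/ (size h <= 1)%N) -> prime_elt f.
Proof.
move=> sf fP fns; have f0 : f != 0 by rewrite -size_poly_gt0 ltnW.
split=> // [|a b [c abc]]; first by rewrite poly_unitE gtn_eqF.
have dvdW k : f %| k -> divides f k.
  case/Pdiv.Idomain.dvdpP=> -[d q] /= d0 e; apply: (primitive_cancel d0 fP).
  by exists q; rewrite mul_polyC.
have fab : f %| a * b by rewrite abc dvdp_mull.
(* Over the fraction field, [f] is either prime to [a] or divides it. *)
have [cop|ncop] := boolP (coprimep f a).
  by right; apply: dvdW; rewrite -(Gauss_dvdpr _ cop).
left; apply: dvdW; have /Pdiv.Idomain.dvdpP[[d q] /= d0 e] := dvdp_gcdl f a.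
rewrite -mul_polyC in e; have [g' [h' [sg sh fgh]]] := primitive_split d0 fP e.
have gcd0 : (0 < size (gcdp f a))%N.
  by rewrite size_poly_gt0 gcdp_eq0 negb_and f0.
have {}ncop : (1 < size (gcdp f a))%N by rewrite ltn_neqAle eq_sym ncop.
have g'1 : size g' = 1%N.
  have g'0 : (0 < size g')%N.
    by rewrite size_poly_gt0; apply: contraNneq f0 => g'0;
      rewrite fgh g'0 mul0r.
  case: (fns g' h' fgh) => [g'1|]; last by rewrite sh leqNgt ncop.
  by apply/eqP; rewrite eqn_leq g'1.
have /eqP : size (gcdp f a) = size f.
  by move/eqP/size_poly1P: g'1 => [x x0 g'x];
    rewrite -sh fgh g'x mul_polyC size_scale.
rewrite dvdp_size_eqp ?dvdp_gcdl // => /eqp_dvdl <-.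
exact: dvdp_gcdr.
Qed.

Lemma primitive_factorization f : primitive_poly f -> f != 0 ->
  exists u (s : seq {poly D}), [/\ u \is a GRing.unit,
    forall p : {poly D}, p \in s -> prime_elt p & f = u * \prod_(p <- s) p].
Proof.
have [k] := ubnP (size f); elim: k => // k IHk in f *.
rewrite ltnS => sk fP f0; have [sf|sf] := leqP (size f) 1.
  have /size_poly1P[c c0 fc] : size f == 1%N by rewrite eqn_leq sf
    size_poly_gt0.
  exists f, [::]; rewrite big_nil mulr1; split=> //.
  have [u [s [uU sP e]]] := facD c0.
  rewrite fc poly_unitE size_polyC c0 coefC eqxx /=.
  case: s sP e => [|p s] sP e; first by rewrite e big_nil mulr1.
  case: (fP p); first by apply: sP; rewrite mem_head.
  rewrite fc; apply: divides_polyCC; exists (u * \prod_(q <- s) q).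
  by rewrite e big_cons mulrCA mulrC.
have [[g [h [fgh [sg sh]]]]|ns] := pselect (exists g h,
  f = g * h /\ (1 < size g)%N /\ (1 < size h)%N); last first.
  exists 1, [:: f]; rewrite unitr1 big_seq1 mul1r; split=> // p.
  rewrite inE => /eqP->; apply: primitive_unsplit_prime => // g h e.
  have [|sg] := leqP (size g) 1; [by left|right]; rewrite leqNgt.
  by apply/negP => sh; apply: ns; exists g, h.
have [gP hP] := primitive_factor fP fgh.
have [g0 h0] : g != 0 /\ h != 0 by apply/andP; rewrite -negb_or -mulf_eq0 -fgh.
have sfgh : size f = (size g + size h).-1 by rewrite fgh size_mul.
have [|u [s [uU sP ge]]] := IHk g _ gP g0.
  by apply: leq_trans sk; rewrite sfgh; case: (size h) sh => [|[|m]] // _;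
    rewrite !addnS ltnS leq_addr.
have [|v [r [vU rP he]]] := IHk h _ hP h0.
  by apply: leq_trans sk; rewrite sfgh; case: (size g) sg => [|[|m]] // _;
    rewrite !addSn ltnS leq_addl.
exists (u * v), (s ++ r); rewrite unitrM uU vU; split=> //.
  by move=> p; rewrite mem_cat => /orP[/sP|/rP].
by rewrite big_cat /= fgh ge he mulrACA.
Qed.

Theorem factorial_poly : factorial_ring {poly D}.
Proof.
move=> f f0; have [c [g [c0 gP fcg]]] := primitive_part f0.
have g0 : g != 0 by apply: contraNneq f0 => g0; rewrite fcg g0 mulr0.
have [u [s [uU sP ge]]] := primitive_factorization gP g0.
have [v [r [vU rP ce]]] := facD c0.
exists (v%:P * u), ([seq p%:P | p <- r] ++ s); split.
- by rewrite unitrM uU andbT rmorph_unit.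
- by move=> p; rewrite mem_cat => /orP[/mapP[q /rP qP ->]|/sP//];
  apply: prime_polyC.
rewrite big_cat /= big_map fcg ge ce polyCM rmorph_prod /=.
by rewrite mulrACA.
Qed.
End Gauss.

Section MPoly.
Variable K : fieldType.

Definition mnm_snoc n (m : 'X_{1..n}) (k : nat) : 'X_{1..n.+1} :=
  [multinom of rcons m k].

Lemma mnm_snoc_inj n (m m' : 'X_{1..n}) k k' :
  (mnm_snoc m k == mnm_snoc m' k') = (m == m') && (k == k').
Proof.
apply/eqP/andP => [[/eqP]|[/eqP-> /eqP->] //].
by rewrite eqseq_rcons => /andP[/eqP/val_inj/val_inj ->].
Qed.

Lemma mnm_snocE n (w : 'X_{1..n.+1}) :
  w = mnm_snoc [multinom w (widen_ord (leqnSn n) i) | i < n] (w ord_max).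
Proof.
apply/mnmP => i; set m := [multinom _ | _ < _].
rewrite [RHS]multinomE (tnth_nth 0%N) /= nth_rcons (size_tuple m).
case: ltnP => [lt|le].
  transitivity (m (Ordinal lt)); last by rewrite multinomE (tnth_nth 0%N).
  by rewrite mnmE; congr (w _); exact: val_inj.
have -> : i = ord_max by apply/val_inj/eqP; rewrite eqn_leq le -ltnS ltn_ord.
by rewrite eqxx.
Qed.

Lemma coeff_muni n (p : {mpoly K[n.+1]}) (k : nat) (m : 'X_{1..n}) :
  (muni p)`_k@_m = p@_(mnm_snoc m k).
Proof.
rewrite muniE coef_sum raddf_sum /= [in RHS](mpolyE p) raddf_sum /=.
apply: eq_bigr => w _; rewrite coefZ coefXn mcoeffZ mcoeffX.
rewrite [in RHS](mnm_snocE w) mnm_snoc_inj (eq_sym k).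
rewrite -mnm_snocE; case: (w ord_max == k).
  by rewrite andbT mulr1 mcoeffZ mcoeffX.
by rewrite andbF !mulr0 mcoeff0.
Qed.

Lemma muni_bij n : exists g, cancel (@muni n K) g /\ cancel g (@muni n K).
Proof.
pose g (q : {poly {mpoly K[n]}}) : {mpoly K[n.+1]} := \sum_(i < size q)
  \sum_(m <- msupp q`_i) q`_i@_m *: 'X_[mnm_snoc m i].
have gK : cancel g (@muni n K).
  move=> q; apply/polyP => k; apply/mpolyP => m; rewrite coeff_muni.
  rewrite /g raddf_sum /=.
  transitivity (\sum_(i < size q | i == k :> nat) q`_i@_m).
    rewrite [RHS]big_mkcond; apply: eq_bigr => i _; rewrite raddf_sum /=.
    rewrite [in RHS](mpolyE q`_i) raddf_sum /=.
    case: eqP => ik; last first.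
      rewrite big1 // => w _; rewrite mcoeffZ mcoeffX mnm_snoc_inj.
      by case: (i == k :> nat) / eqP ik; rewrite ?andbF ?mulr0.
    apply: eq_bigr => w _; rewrite !mcoeffZ !mcoeffX mnm_snoc_inj ik eqxx.
    by rewrite andbT.
  have [lt|le] := ltnP k (size q); first by rewrite (big_pred1 (Ordinal lt)).
  rewrite nth_default // mcoeff0 big_pred0 // => i.
  by apply/negbTE; rewrite neq_ltn (leq_trans (ltn_ord i) le).
exists g; split=> // p; apply/mpolyP => w.
by rewrite [w]mnm_snocE -!coeff_muni gK.
Qed.

Theorem factorial_mpoly n : factorial_ring {mpoly K[n]}.
Proof.
elim: n => [|n IHn].
  move=> p p0; exists p, [::]; rewrite big_nil mulr1; split=> //.
  have pE : p = (p@_0)%:MP.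
    apply/mpolyP => m; rewrite mcoeffC.
    by have -> : m = 0%MM by [apply/mnmP => -[]]; rewrite eqxx mulr1.
  have c0 : p@_0 != 0 by apply: contraNneq p0 => c0; rewrite pE c0.
  apply/unitrPr; exists ((p@_0)^-1)%:MP.
  by rewrite {1}pE -mpolyCM divff.
have [g [muniK gK]] := muni_bij n.
exact: (factorial_transport muniK gK (factorial_poly IHn)).
Qed.
End MPoly.

(** * Farkas' lemma *)

Section Dot.
Variables (R : comNzRingType) (m : nat).
Implicit Types a b u v : 'rV[R]_m.

Definition dot a u : R := \sum_i a 0 i * u 0 i.

Lemma dotC a u : dot a u = dot u a.
Proof. by apply: eq_bigr => i _; rewrite mulrC. Qed.

Lemma dotDr a u v : dot a (u + v) = dot a u + dot a v.
Proof. by rewrite -big_split; apply: eq_bigr => i _; rewrite mxE mulrDr. Qed.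

Lemma dotZr a k u : dot a (k *: u) = k * dot a u.
Proof. by rewrite mulr_sumr; apply: eq_bigr => i _; rewrite mxE mulrCA. Qed.

Lemma dotDl a b u : dot (a + b) u = dot a u + dot b u.
Proof. by rewrite dotC dotDr !(dotC u). Qed.

Lemma dotZl a k u : dot (k *: a) u = k * dot a u.
Proof. by rewrite dotC dotZr dotC. Qed.

Lemma dotNr a u : dot a (- u) = - dot a u.
Proof. by rewrite -scaleN1r dotZr mulN1r. Qed.

Lemma dotNl a u : dot (- a) u = - dot a u.
Proof. by rewrite dotC dotNr dotC. Qed.

Lemma dotBr a u v : dot a (u - v) = dot a u - dot a v.
Proof. by rewrite dotDr dotNr. Qed.

Lemma dotBl a b u : dot (a - b) u = dot a u - dot b u.
Proof. by rewrite dotDl dotNl. Qed.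

Lemma dot0r a : dot a 0 = 0.
Proof. by rewrite -(scale0r 0) dotZr mul0r. Qed.

Lemma dotMnr a u k : dot a (u *+ k) = dot a u *+ k.
Proof. by rewrite -scaler_nat dotZr mulr_natl. Qed.

Lemma dot_sumr a I (s : seq I) (P : pred I) (F : I -> 'rV[R]_m) :
  dot a (\sum_(i <- s | P i) F i) = \sum_(i <- s | P i) dot a (F i).
Proof. exact: (big_morph (dot a) (dotDr a) (dot0r a)). Qed.

Lemma dot_delta a i : dot a (delta_mx 0 i) = a 0 i.
Proof.
rewrite /dot (bigD1 i) //= mxE !eqxx mulr1 big1 ?addr0 // => j ji.
by rewrite mxE (negPf ji) andbF mulr0.
Qed.

End Dot.

Lemma dot_map (R S : comNzRingType) (f : {rmorphism R -> S}) m
    (a u : 'rV[R]_m) : dot (map_mx f a) (map_mx f u) = f (dot a u).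
Proof. by rewrite rmorph_sum; apply: eq_bigr => i _; rewrite !mxE rmorphM. Qed.

Section Farkas.
Variables (F : realFieldType) (m : nat).
Implicit Types (u v g a b : 'rV[F]_m) (s : seq 'rV[F]_m).

(** The nonnegative combinations of [s], with the coefficients chosen one at a
    time to suit the induction on [s] in Farkas' lemma. *)
Fixpoint in_cone s u : Prop :=
  if s is g :: s' then exists2 c, 0 <= c & in_cone s' (u - c *: g) else u = 0.

Lemma in_cone_dot s u a : in_cone s u -> {in s, forall g, 0 <= dot a g} ->
  0 <= dot a u.
Proof.
elim: s u => [|g s IHs] u /=; first by move=> ->; rewrite dot0r.
move=> [c c0 /IHs h] ag.
have := h (fun g' g's => ag g' (mem_behead (s := g :: s) g's)).
rewrite dotBr dotZr subr_ge0; apply: le_trans.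
by rewrite mulr_ge0 // ag // mem_head.
Qed.

(** Farkas' lemma by induction on the generators (Bartl): if [a] separates [u]
    from the cone on [s] but not from the cone on [g :: s], then project along
    [g] onto the hyperplane orthogonal to [a]. *)
Lemma farkas s u : in_cone s u \/
  exists2 a, {in s, forall g, 0 <= dot a g} & dot a u < 0.
Proof.
have [k] := ubnP (size s); elim: k => // k IHk in s u *.
case: s => [_|g s].
  have [->|u0] := eqVneq u 0; [by left|right; exists (- u) => //].
  rewrite dotNl oppr_lt0 lt_neqAle sumr_ge0 => [|i _];
    last by rewrite -expr2 sqr_ge0.
  rewrite andbT eq_sym; apply: contra_neq u0 => u0; apply/rowP => i.
  rewrite mxE; apply/eqP; rewrite -sqrf_eq0 expr2; apply/eqP.
  by move: i (erefl true); apply: (psumr_eq0P _ u0) => i _;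
    rewrite -expr2 sqr_ge0.
rewrite /= ltnS => sk.
have [su|[a as_ au]] := IHk s u sk; first by left; exists 0;
  rewrite ?scale0r ?subr0.
have [ag|ag] := leP 0 (dot a g).
  by right; exists a => // h; rewrite inE => /orP[/eqP->|/as_].
pose pr v := v - (dot a v / dot a g) *: g.
have ag0 : dot a g != 0 by rewrite lt_eqF.
have [|pu|[b bs bu]] := IHk [seq pr v | v <- s] (pr u);
  first by rewrite size_map.
  left.
  (* Lift [pr u] to the cone on [s]; the lift differs from [u] by a multiple
     of [g], which is nonnegative by comparing values of [a]. *)
  have [v [sv pruv]] : exists v, in_cone s v /\ pr u = pr v.
    move: (pr u) pu => {sk au as_ u}; elim: s => [|h s IHs] w /=.
      by move=> ->; exists 0; rewrite /pr dot0r mul0r scale0r subr0.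
    move=> [c c0 /IHs[v [sv e]]]; exists (v + c *: h); split.
      by exists c => //; rewrite addrK.
    rewrite -(subrK (c *: pr h) w) e /pr dotDr dotZr mulrDl scalerDl opprD.
    by rewrite -!addrA; congr (_ + _); rewrite scalerBr scalerA mulrA addrCA.
  exists ((dot a u - dot a v) / dot a g).
    rewrite mulr_le0 // ?invr_le0 ?(ltW ag) // subr_le0 ltW //.
    by apply: lt_le_trans au _; apply: in_cone_dot sv _ => h /as_.
  rewrite mulrBl scalerBl opprB addrCA -/(pr u) pruv /pr.
  by rewrite addrC subrK.
have prE v : dot (b - (dot b g / dot a g) *: a) v = dot b (pr v).
  by rewrite dotBl dotZl /pr dotBr dotZr; congr (_ - _); field.
right; exists (b - (dot b g / dot a g) *: a) => [h|]; last by rewrite prE.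
rewrite inE prE => /orP[/eqP->|hs]; last by apply: bs; apply: map_f.
by rewrite /pr divff // scale1r subrr dot0r.
Qed.

Lemma in_cone_sum (I : eqType) (s : seq I) (p : I -> 'rV[F]_m) u :
  uniq s -> in_cone [seq p i | i <- s] u ->
  exists2 c : I -> F, forall i, 0 <= c i & u = \sum_(i <- s) c i *: p i.
Proof.
elim: s u => [|i s IHs] u /=; first by move=> _ ->; exists (fun=> 0);
  rewrite ?big_nil.
move=> /andP[is_ us] [c c0 /(IHs _ us)[d d0 e]].
exists (fun j => if j == i then c else d j) => [j|]; first by case: ifP.
rewrite big_cons eqxx; rewrite -(subrK (c *: p i) u) addrC e; congr (_ + _).
apply: eq_big_seq => j js /=.
by case: eqP => // ji; rewrite -ji js in is_.
Qed.

(** A separating form can be chosen to define a facet: as long as some form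
    [b], not a multiple of [a], vanishes on the same generators as [a], arrange
    [b u = 0] by subtracting a multiple of [a], and move [a] in the direction of
    [b] until it vanishes on one more generator. *)
Lemma farkas_facet (I : finType) (p : I -> 'rV[F]_m) u :
  (forall a, (forall i, dot a (p i) = 0) -> a = 0) ->
  (exists2 c : I -> F, forall i, 0 <= c i & u = \sum_i c i *: p i) \/
  exists a, [/\ forall i, 0 <= dot a (p i), dot a u < 0 &
    forall b, (forall i, dot a (p i) = 0 -> dot b (p i) = 0) ->
      exists l, b = l *: a].
Proof.
move=> span; have [/in_cone_sum h|[a0 a0p a0u]] :=
  farkas [seq p i | i <- enum I] u.
  left; have [|c c0 e] := h; first exact: enum_uniq.
  by exists c => //; rewrite e big_enum.
right; have {}a0p i : 0 <= dot a0 (p i) by apply: a0p; rewrite map_f ?mem_enum.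
have [k] := ubnP #|[set i | dot a0 (p i) != 0]|.
elim: k => // k IHk in a0 a0u a0p *; rewrite ltnS => ak.
have [[b [bp bu bn0]]|nb] := pselect (exists b,
  [/\ forall i, dot a0 (p i) = 0 -> dot b (p i) = 0, dot b u = 0 & b != 0]);
  last first.
  exists a0; split=> // b bp; exists (dot b u / dot a0 u).
  apply: contrapT => bne; apply: nb; exists (b - (dot b u / dot a0 u) *: a0);
    split.
  - by move=> i a0i; rewrite dotBl dotZl a0i bp // mulr0 subr0.
  - by rewrite dotBl dotZl divfK ?subrr // lt_eqF.
  - by rewrite subr_eq0; apply/eqP.
have {bn0 bp bu b} [b [bp bu [i0 bi0]]] : exists b,
    [/\ forall i, dot a0 (p i) = 0 -> dot b (p i) = 0, dot b u = 0 &
      exists i, dot b (p i) < 0].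
  have [i bi] : exists i, dot b (p i) != 0.
    apply: contrapT => h; move/eqP: bn0; apply; apply: span => i.
    by apply/eqP; apply: contrapT => /negP bi; apply: h; exists i.
  have [bneg|bpos] := ltP (dot b (p i)) 0; first by exists b; split=> //;
    exists i.
  exists (- b); split=> [j /bp bj||]; rewrite ?dotNl ?bj ?bu ?oppr0 //.
  by exists i; rewrite dotNl oppr_lt0 lt_neqAle eq_sym bi.
have ap i : dot b (p i) < 0 -> 0 < dot a0 (p i).
  by move=> bi; rewrite lt_neqAle a0p andbT eq_sym;
    apply: contraTneq bi => /bp->; rewrite ltxx.
(* [step i] is the length of the step along [b] after which [a0] vanishes on
   [p i]; the shortest one keeps all the other values nonnegative. *)
pose step i := dot a0 (p i) / - dot b (p i).
pose P i := dot b (p i) < 0.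
case: (@arg_minP _ _ _ i0 P step bi0) => j bj jmin {i0 bi0}.
have l0 : 0 < step j by rewrite divr_gt0 ?ap // oppr_gt0.
have sE i : dot (a0 + step j *: b) (p i) = dot a0 (p i) + step j * dot b (p i).
  by rewrite dotDl dotZl.
apply: (IHk (a0 + step j *: b)); first by rewrite dotDl dotZl bu mulr0 addr0.
  move=> i; rewrite sE; have [bi|bi] := ltP (dot b (p i)) 0; last first.
    by rewrite addr_ge0 // mulr_ge0 // ltW.
  have := jmin i bi; rewrite {2}/step ler_pdivlMr ?oppr_gt0 // mulrN.
  by rewrite -subr_ge0 opprK.
apply: leq_trans ak; apply: proper_card; apply/properP; split.
  apply/fintype.subsetP => i; rewrite !inE; apply: contraNneq => ai.
  by rewrite sE ai bp // mulr0 addr0.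
exists j; first by rewrite inE gt_eqF // ap.
rewrite inE sE negbK /step invrN mulrN mulNr divfK ?subrr //.
by rewrite lt_eqF.
Qed.
End Farkas.

(** * Facets of the cone and the lattice points inside *)

Lemma common_denominator (I : finType) (x : I -> rat) :
  exists2 k : nat, (0 < k)%N & forall i, exists z : int, k%:R * x i = z%:~R.
Proof.
exists (\prod_i absz (denq (x i)))%N => [|i].
  by rewrite prodn_gt0 // => i; rewrite absz_gt0 denq_neq0.
exists ((\prod_(j | j != i) `|denq (x j)|)%N%:Z * numq (x i)).
rewrite (bigD1 i) //= mulnC natrM -mulrA intrM -[_%:~R]/(_%:R); congr (_ * _).
by rewrite numqE mulrC -[in RHS]absz_denq.
Qed.

(** A nonzero integral form takes a least positive value, which divides all its
    values and hence all its coefficients. *)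
Lemma primitive_form m (a : 'rV[int]_m) : a != 0 ->
  exists d (b : 'rV[int]_m), [/\ 0 < d, a = d *: b & exists z, dot b z = 1].
Proof.
move=> a0; have ex : exists k, `[< (0 < k)%N /\ exists z, dot a z = k%:Z >].
  have [i ai] : exists i, a 0 i != 0.
    apply: contrapT => h; move/eqP: a0; apply; apply/rowP => i; rewrite mxE.
    by apply/eqP; apply: contrapT => /negP ai; apply: h; exists i.
  exists (absz (a 0 i)); apply/asboolP; rewrite absz_gt0; split=> //.
  exists (Num.sg (a 0 i) *: delta_mx 0 i).
  by rewrite dotZr dot_delta abszE normrEsg.
case: (ex_minnP ex) => d /asboolP[d_gt0 [z az]] dmin.
have dvd v : (d%:Z %| dot a v)%Z.
  apply/dvdz_mod0P/eqP; apply: contrapT => /negP rn0.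
  have r0 : (0 < (dot a v %% d)%Z) by rewrite lt_neqAle eq_sym rn0 modz_ge0 //
    -lt0n.
  suff : (d <= absz (dot a v %% d)%Z)%N.
    by rewrite leqNgt -ltz_nat gez0_abs ?(ltW r0) // ltz_pmod.
  apply: dmin; apply/asboolP; rewrite absz_gt0; split=> //.
  exists (v - (dot a v %/ d)%Z *: z);
    rewrite dotBr dotZr az gez0_abs ?(ltW r0) //.
exists d%:Z, (\row_i (a 0%R i %/ d)%Z); split=> //.
  apply/rowP => i; rewrite !mxE mulrC divzK //.
  by have := dvd (delta_mx 0 i); rewrite dot_delta.
exists z; apply: (mulfI (x := d%:Z)); first by rewrite gt_eqF.
rewrite mulr1 -dotZl -[RHS]az; congr dot; apply/rowP => i;
  rewrite !mxE mulrC divzK //.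
by have := dvd (delta_mx 0 i); rewrite dot_delta.
Qed.

Section Lattice.
Variables (n : nat) (Delta : simplicial_complex n).
Implicit Types (a b u v : 'rV[int]_n.+1).

Definition face_type : finType := {F : {set 'I_n} | F \in faces Delta}.

Definition point (F : face_type) : 'rV[int]_n.+1 := lattice_point (val F).

Definition face_empty : face_type := exist _ finset.set0 (face0 Delta).
Definition face_vertex (i : 'I_n) : face_type :=
  exist _ [set i]%SET (face1 Delta i).

Lemma dot_lattice_point (R : comNzRingType) (a : 'rV[R]_n.+1) (F : {set 'I_n}) :
  dot a (map_mx intr (lattice_point F)) =
  \sum_(i in F) a 0 (widen_ord (leqnSn n) i) + a 0 ord_max.
Proof.
rewrite map_mxD map_delta_mx raddf_sum /= dotDr dot_sumr dot_delta;
  congr (_ + _).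
by apply: eq_bigr => i _; rewrite map_delta_mx dot_delta.
Qed.

Lemma map_intr_int m (a : 'rV[int]_m) : map_mx intr a = a.
Proof. by apply/rowP => i; rewrite mxE intz. Qed.

Lemma dot_pointE a (F : face_type) :
  dot a (point F) = \sum_(i in val F) a 0 (widen_ord (leqnSn n) i) + a 0
    ord_max.
Proof. by rewrite -dot_lattice_point map_intr_int. Qed.

Lemma dot_point_empty (R : comNzRingType) (a : 'rV[R]_n.+1) :
  dot a (map_mx intr (point face_empty)) = a 0 ord_max.
Proof. by rewrite dot_lattice_point big_set0 add0r. Qed.

Lemma dot_point_vertex (R : comNzRingType) (a : 'rV[R]_n.+1) i :
  dot a (map_mx intr (point (face_vertex i))) =
  a 0 (widen_ord (leqnSn n) i) + a 0 ord_max.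
Proof. by rewrite dot_lattice_point big_set1. Qed.

Lemma ord_widen_or_max (i : 'I_n.+1) :
  i = ord_max \/ exists j, i = widen_ord (leqnSn n) j.
Proof.
have [lt|le] := ltnP i n; [right|left].
  by exists (Ordinal lt); apply: val_inj.
by apply/val_inj/eqP; rewrite eqn_leq le -ltnS ltn_ord.
Qed.

Lemma points_span (R : comNzRingType) (a : 'rV[R]_n.+1) :
  (forall F, dot a (map_mx intr (point F)) = 0) -> a = 0.
Proof.
move=> h; have am : a 0 ord_max = 0 by rewrite -dot_point_empty h.
apply/rowP => i; rewrite mxE; have [->//|[j ->]] := ord_widen_or_max i.
by have := h (face_vertex j); rewrite dot_point_vertex am addr0.
Qed.

Definition in_monoid v : Prop :=
  exists c : face_type -> nat, v = \sum_F point F *+ c F.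

Lemma in_monoid0 : in_monoid 0.
Proof. by exists (fun=> 0%N); rewrite big1. Qed.

Lemma in_monoidD u v : in_monoid u -> in_monoid v -> in_monoid (u + v).
Proof.
move=> [c ->] [d ->]; exists (fun F => c F + d F)%N.
by rewrite -big_split; apply: eq_bigr => F _; rewrite mulrnDr.
Qed.

Lemma in_monoid_point F : in_monoid (point F).
Proof.
exists (fun G => (G == F) : nat).
by rewrite (bigD1 F) //= eqxx mulr1n big1 ?addr0 // => G /negPf ->.
Qed.

Lemma in_monoidMn v k : in_monoid v -> in_monoid (v *+ k).
Proof.
move=> vS; elim: k => [|k IHk]; first exact: in_monoid0.
by rewrite mulrS; apply: in_monoidD.
Qed.

Lemma in_monoid_sum I (s : seq I) (P : pred I) (f : I -> 'rV[int]_n.+1) :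
  (forall i, P i -> in_monoid (f i)) -> in_monoid (\sum_(i <- s | P i) f i).
Proof.
by move=> h; apply: (big_ind in_monoid) => //;
  [apply: in_monoid0|apply: in_monoidD].
Qed.

Lemma in_monoid_dot_ge0 a v : (forall F, 0 <= dot a (point F)) -> in_monoid v ->
  0 <= dot a v.
Proof.
by move=> h [c ->]; rewrite dot_sumr sumr_ge0 // => F _;
  rewrite dotMnr mulrn_wge0.
Qed.

Lemma coord_point_ge0 i F : 0 <= point F 0 i.
Proof.
rewrite /point /lattice_point mxE summxE addr_ge0 ?sumr_ge0 // => [j _|];
by rewrite mxE; case: (_ && _).
Qed.

Lemma in_monoid_coord_ge0 v i : in_monoid v -> 0 <= v 0 i.
Proof.
move=> vS; rewrite -dot_delta dotC; apply: in_monoid_dot_ge0 vS => F.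
by rewrite dotC dot_delta coord_point_ge0.
Qed.

(** The primitive integral forms of the facets that avoid [e_(n+1)]. That the
    face where [a] vanishes has dimension [n] is expressed without ranks: a form
    [b] vanishing there is a multiple of [a], and its factor is read off at
    [e_(n+1)]. *)
Definition facet_form a : Prop :=
  [/\ 0 < a 0 ord_max, forall F, 0 <= dot a (point F),
    forall b, (forall F, dot a (point F) = 0 -> dot b (point F) = 0) ->
      a 0 ord_max *: b = b 0 ord_max *: a &
    exists z, dot a z = 1].

Definition vanishing a : {set face_type} := [set F | dot a (point F) == 0]%SET.

(** The two forms are proportional, and by primitivity each of their values at
    [e_(n+1)] divides the other. *)
Lemma facet_form_inj a b : facet_form a -> facet_form b ->
  vanishing a \subset vanishing b -> a = b.
Proof.
move=> [a0 _ ak [z az]] [b0 _ _ [y by_]] /fintype.subsetP ab.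
have e : a 0 ord_max *: b = b 0 ord_max *: a.
  apply: ak => F aF; have := ab F; rewrite !inE aF eqxx => /(_ isT)/eqP; exact.
suff ab1 : a 0 ord_max = b 0 ord_max.
  apply/rowP => i; have /rowP/(_ i) := e; rewrite !mxE ab1.
  by move/(mulfI (lt0r_neq0 b0)).
have /(congr1 (fun v => dot v z)) := e; have /(congr1 (fun v => dot v y)) := e.
rewrite !dotZl az by_ !mulr1 => ey ez.
apply/eqP; rewrite eq_le; apply/andP; split.
  have bz : 0 < dot b z by rewrite -(pmulr_rgt0 _ a0) ez.
  by rewrite -ez ler_peMr ?(ltW a0) // -gtz0_ge1.
have ay : 0 < dot a y by rewrite -(pmulr_rgt0 _ b0) -ey.
by rewrite ey ler_peMr ?(ltW b0) // -gtz0_ge1.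
Qed.

(** There are finitely many facet forms because they are determined by the
    generators on which they vanish. *)
Lemma enum_facet_forms : exists r (L : 'I_r -> 'rV[int]_n.+1),
  [/\ forall j, facet_form (L j), injective L &
    forall a, facet_form a -> exists j, a = L j].
Proof.
pose A := [set T : {set face_type} |
  `[< exists2 a, facet_form a & T = vanishing a >] ]%SET.
have AP (j : 'I_#|A|) : {a | facet_form a /\ enum_val j = vanishing a}.
  apply: cid; have := enum_valP j; rewrite inE => /asboolP[a ? ?]; by exists a.
exists #|A|, (fun j => projT1 (AP j)); split.
- by move=> j; have [] := projT2 (AP j).
- move=> i j e; apply: enum_val_inj.
  by have [_ ->] := projT2 (AP i); have [_ ->] := projT2 (AP j); rewrite e.
move=> a aF; have aA : vanishing a \in A by rewrite inE; apply/asboolP;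
  exists a.
exists (enum_rank_in aA (vanishing a)).
have [bF e] := projT2 (AP (enum_rank_in aA (vanishing a))).
by apply: facet_form_inj => //; rewrite -e enum_rankK_in.
Qed.

Lemma rational_facet_form (a : 'rV[rat]_n.+1) :
  0 < a 0 ord_max -> (forall F, 0 <= dot a (map_mx intr (point F))) ->
  (forall b : 'rV[rat]_n.+1, (forall F, dot a (map_mx intr (point F)) = 0 ->
     dot b (map_mx intr (point F)) = 0) -> exists l, b = l *: a) ->
  exists2 b : 'rV[int]_n.+1, facet_form b & exists2 l :
    rat, 0 < l & a = l *: map_mx intr b.
Proof.
move=> a0 aF aker; have [k k0 ck] := common_denominator (a 0).
pose a1 : 'rV[int]_n.+1 := \row_i projT1 (cid (ck i)).
have a1E : map_mx intr a1 = k%:R *: a.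
  by apply/rowP => i; rewrite !mxE; case: cid.
have kQ : 0 < k%:R :> rat by rewrite ltr0n.
have a1n0 : a1 != 0.
  apply: contraTneq a0 => a10; move: a1E; rewrite a10 => /rowP/(_ ord_max).
  by rewrite !mxE => /eqP; rewrite eq_sym mulf_eq0 gt_eqF //= => /eqP->;
    rewrite ltxx.
have [d [b [d0 a1b [z bz]]]] := primitive_form a1n0.
have dQ : 0 < d%:~R :> rat by rewrite ltr0z.
have ab : a = (d%:~R / k%:R) *: map_mx intr b.
  apply: (scalerI (a := k%:R : rat)); first by rewrite gt_eqF.
  by rewrite scalerA mulrCA divff ?gt_eqF // mulr1 -a1E a1b map_mxZ.
have l0 : 0 < d%:~R / k%:R :> rat by rewrite divr_gt0.
exists b; last by exists (d%:~R / k%:R).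
have dotE F : dot a (map_mx intr (point F)) = d%:~R / k%:R * (dot b (point
  F))%:~R.
  by rewrite ab dotZl dot_map.
split; last by exists z.
- by move: a0; rewrite ab !mxE pmulr_rgt0 // ltr0z.
- by move=> F; have := aF F; rewrite dotE pmulr_rge0 // ler0z.
move=> c ch; have [F|l cl] := aker (map_mx intr c).
  rewrite dotE => /eqP; rewrite mulf_eq0 gt_eqF //= intr_eq0 => /eqP/ch.
  by rewrite dot_map => ->.
have cE i : (c 0 i)%:~R = l * (d%:~R / k%:R) * (b 0 i)%:~R :> rat.
  by have /rowP/(_ i) := cl; rewrite ab !mxE mulrA.
apply/rowP => i; rewrite !mxE; apply: (@intr_inj rat); rewrite !intrM !cE.
by rewrite mulrCA mulrA.
Qed.

Definition saturated := forall k v, (0 < k)%N -> in_monoid (v *+ k) ->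
  in_monoid v.

(** If [u] were outside of the cone, a form defining a facet would separate it.
    When this facet avoids [e_(n+1)], its primitive multiple is a facet form;
    otherwise the form has no component along [e_(n+1)] and its other
    coefficients are its values at the vertices, so it is nonnegative at [u]. *)
Lemma saturated_facets u : saturated ->
  (forall i, 0 <= u 0 (widen_ord (leqnSn n) i)) ->
  (forall a, facet_form a -> 0 <= dot a u) -> in_monoid u.
Proof.
move=> satS uc uL; have span := @points_span rat.
have [[c c0 ue]|[a [aF au aker]]] :=
    farkas_facet (map_mx intr u) span.
  have [k k0 /choice[z zE]] := common_denominator c; apply: (satS k) => //.
  exists (fun F => absz (z F)); apply/rowP => i.
  have /rowP/(_ i) := ue; rewrite mxE summxE => ui.
  apply: (@intr_inj rat); rewrite mulmxnE rmorphMn /= ui -mulr_natl mulr_sumr.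
  rewrite summxE rmorph_sum; apply: eq_bigr => F _; rewrite mulmxnE rmorphMn /=.
  rewrite !mxE mulrA zE -[in RHS]mulr_natl; congr (_ * _).
  rewrite -[_%:R]/((absz (z F))%:Z%:~R) gez0_abs // -(ler0z rat) -zE.
  by rewrite mulr_ge0 // ler0n.
have am := aF face_empty; rewrite dot_point_empty le_eqVlt in am.
case/orP: am => [/eqP am|am].
  have ai i : 0 <= a 0 (widen_ord (leqnSn n) i).
    by have := aF (face_vertex i); rewrite dot_point_vertex -am addr0.
  suff : 0 <= dot a (map_mx intr u) by rewrite leNgt au.
  rewrite /dot big_ord_recr /= -am mul0r addr0 sumr_ge0 // => i _.
  by rewrite mxE mulr_ge0 // ler0z.
have [b bF [l l0 ab]] := rational_facet_form am aF aker.
by move: au; rewrite ab dotZl dot_map pmulr_rlt0 // ltrz0 ltNge uL.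
Qed.

Lemma widen_neq_max (i : 'I_n) : (widen_ord (leqnSn n) i == ord_max) = false.
Proof. by rewrite -val_eqE /= ltn_eqF ?ltn_ord. Qed.

Lemma widen_inj : injective (widen_ord (leqnSn n)).
Proof. by move=> i j /(congr1 val)/= e; apply: val_inj. Qed.

Lemma indicatorE (C : {set 'I_n}) i :
  (\sum_(j in C) delta_mx 0 (widen_ord (leqnSn n) j) : 'rV[int]_n.+1) 0
    (widen_ord (leqnSn n) i) = (i \in C)%:R.
Proof.
rewrite summxE; have [iC|iC] := boolP (i \in C).
  rewrite (bigD1 i) //= mxE !eqxx big1 ?addr0 // => j /andP[_ ji].
  by rewrite mxE (inj_eq widen_inj) eq_sym (negPf ji) andbF.
rewrite big1 // => j jC; rewrite mxE (inj_eq widen_inj).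
by case: (i =P j) => [ij|_]; [rewrite ij jC in iC|rewrite andbF].
Qed.

Lemma indicator_max (C : {set 'I_n}) :
  (\sum_(j in C) delta_mx 0 (widen_ord (leqnSn n) j) : 'rV[int]_n.+1) 0
    ord_max = 0.
Proof.
by rewrite summxE big1 // => i _; rewrite mxE eq_sym widen_neq_max.
Qed.

Lemma point_coord F (i : 'I_n) :
  point F 0 (widen_ord (leqnSn n) i) = (i \in val F)%:R.
Proof. by rewrite mxE indicatorE mxE widen_neq_max addr0. Qed.

Lemma point_max F : point F 0 ord_max = 1.
Proof. by rewrite mxE indicator_max mxE !eqxx add0r. Qed.

(** A lattice point in the relative interior of the facet of [a]: inverting its
    monomial leaves [a >= 0] as the only constraint on the exponents. *)
Definition facet_sum a : 'rV[int]_n.+1 :=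
  \sum_(F | dot a (point F) == 0) point F.

Lemma facet_sum_monoid a : in_monoid (facet_sum a).
Proof. by apply: in_monoid_sum => F _; apply: in_monoid_point. Qed.

Lemma dot_facet_sum a : dot a (facet_sum a) = 0.
Proof. by rewrite dot_sumr big1 // => F /eqP. Qed.

Lemma facet_sum_gt0 a b : facet_form a -> (forall F, 0 <= dot b (point F)) ->
  (forall F, dot a (point F) = 0 -> dot b (point F) = 0) \/
  0 < dot b (facet_sum a).
Proof.
move=> aF b0; have : 0 <= dot b (facet_sum a).
  by rewrite dot_sumr sumr_ge0.
rewrite le_eqVlt => /orP[/eqP e|]; [left|by right] => F aF0.
move/esym: e; rewrite dot_sumr => /psumr_eq0P; apply=> //.
by apply/eqP.
Qed.

Lemma facet_sum_facet a b : facet_form a -> facet_form b -> a <> b ->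
  0 < dot b (facet_sum a).
Proof.
move=> aF bF ab; have [_ b0 _ _] := bF.
case: (facet_sum_gt0 aF b0) => // h; case: ab; apply: facet_form_inj => //.
by apply/fintype.subsetP => F; rewrite !inE => /eqP/h->.
Qed.

Lemma facet_sum_coord a i : facet_form a ->
  0 < facet_sum a 0 (widen_ord (leqnSn n) i).
Proof.
move=> aF; have [a0 _ aker _] := aF; rewrite -dot_delta dotC.
case: (@facet_sum_gt0 a (delta_mx 0 (widen_ord (leqnSn n) i)) aF) => // [F|].
  by rewrite dotC dot_delta coord_point_ge0.
move/aker/rowP/(_ (widen_ord (leqnSn n) i)); rewrite !mxE !eqxx /= mulr1.
by rewrite eq_sym widen_neq_max mul0r => e; rewrite e ltxx in a0.
Qed.

Lemma mulrz_absz_ge0 (x y : int) (N : nat) : 0 < y -> (absz x <= N)%N ->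
  0 <= x + y *+ N.
Proof. by move=> y0 xN; rewrite -mulr_natr natz; nia. Qed.

(** Away from [a], all facet forms and coordinates are positive on
    [facet_sum a]. *)
Lemma facet_local a u : saturated -> facet_form a -> 0 <= dot a u ->
  exists N, in_monoid (u + facet_sum a *+ N).
Proof.
move=> satS aF au; have [r [L [LF _ Lsurj]]] := enum_facet_forms.
exists (\sum_j absz (dot (L j) u) + \sum_i absz (u 0%R i))%N.
apply: saturated_facets => // [i|b bF].
  rewrite mxE mulmxnE; apply: mulrz_absz_ge0; first exact: facet_sum_coord.
  by rewrite (bigD1 (widen_ord (leqnSn n) i)) //= addnCA leq_addr.
rewrite dotDr dotMnr; have [<-|/eqP ab] := eqVneq a b.
  by rewrite dot_facet_sum mul0rn addr0.
apply: mulrz_absz_ge0; first exact: facet_sum_facet.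
by have [j ->] := Lsurj b bF; rewrite (bigD1 j) //= -addnA leq_addr.
Qed.

Lemma facet_uniformizer a : saturated -> facet_form a ->
  exists2 g, in_monoid g & dot a g = 1.
Proof.
move=> satS aF; have [_ _ _ [z az]] := aF.
have [|N gS] := facet_local (u := z) satS aF; first by rewrite az.
by exists (z + facet_sum a *+ N);
  rewrite // dotDr dotMnr dot_facet_sum mul0rn addr0.
Qed.

(** For [u = - e_(n+1)] this says that a power of the monomial of [w] is
    divisible by [t]. *)
Lemma interior_local w u : saturated -> in_monoid w ->
  (forall a, facet_form a -> 0 < dot a w) ->
  (forall i, 0 <= u 0 (widen_ord (leqnSn n) i)) ->
  exists N, in_monoid (u + w *+ N).
Proof.
move=> satS wS wL uc; have [r [L [LF _ Lsurj]]] := enum_facet_forms.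
exists (\sum_j absz (dot (L j) u))%N.
apply: saturated_facets => // [i|b bF].
  by rewrite mxE mulmxnE addr_ge0 // mulrn_wge0 // in_monoid_coord_ge0.
rewrite dotDr dotMnr; apply: mulrz_absz_ge0; first exact: wL.
by have [j ->] := Lsurj b bF; rewrite (bigD1 j) //= leq_addr.
Qed.

(** A maximal set [C] of pairwise non-adjacent vertices meets each face at most
    once, so that [x_(n+1) - \sum_(i in C) x_i] is nonnegative. It defines a
    facet: it vanishes on the [n] independent points of the faces [{i}] for [i]
    in [C], and [{i, k}] for [k] outside of [C] and [i] in [C] adjacent to
    [k]. *)
Lemma unit_facet_form : exists2 a, facet_form a & a 0 ord_max = 1.
Proof.
pose w := widen_ord (leqnSn n).
pose indep (C : {set 'I_n}) := [forall i in C, forall j in C,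
  (i != j) ==> ([set i; j]%SET \notin faces Delta)].
have [|C /maxsetP[Cind Cmax]] := @ex_maxset _ indep.
  by exists finset.set0; apply/forall_inP => i; rewrite inE.
have {}Cind i j : i \in C -> j \in C -> i != j -> [set i;
  j]%SET \notin faces Delta.
  by move=> iC jC; apply: (implyP (forall_inP (forall_inP Cind i iC) j jC)).
pose a : 'rV[int]_n.+1 := delta_mx 0 ord_max - \sum_(i in C) delta_mx 0 (w i).
have am : a 0 ord_max = 1.
  by rewrite mxE [X in _ + X]mxE indicator_max mxE !eqxx subr0.
have aw i : a 0 (w i) = - (i \in C)%:R.
  by rewrite mxE [X in _ + X]mxE indicatorE mxE widen_neq_max sub0r.
have aP (F : face_type) : dot a (point F) = 1 - (#|(C :&: val F)%SET|)%:R.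
  rewrite dot_pointE am addrC; congr (_ + _).
  rewrite (eq_bigr (fun i => - (i \in C)%:R)); last by move=> i _; apply: aw.
  rewrite sumrN; congr (- _); rewrite -sum1_card natr_sum big_mkcond
    [RHS]big_mkcond.
  by apply: eq_bigr => i _; rewrite inE andbC; case: (i \in val F);
    case: (i \in C).
have Fle (F : face_type) : (#|(C :&: val F)%SET| <= 1)%N.
  rewrite leqNgt; apply/negP => /card_gt1P[i [j [iCF jCF ij]]].
  move: iCF jCF; rewrite !inE => /andP[iC iF] /andP[jC jF].
  case/negP: (Cind i j iC jC ij); apply: (face_sub (valP F)).
  by rewrite finset.subUset !finset.sub1set iF jF.
exists a => //; split; rewrite ?am //.
- by move=> F; rewrite aP; case: #|_| (Fle F) => [|[|]].
- move=> b bT; rewrite scale1r.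
  have bC i : i \in C -> b 0 (w i) = - b 0 ord_max.
    move=> iC; apply/eqP; rewrite -addr_eq0 -[b]map_intr_int !mxE !intz.
    have := bT (face_vertex i); rewrite aP !dot_pointE /= big_set1 => -> //.
    have -> : (C :&: [set i] = [set i])%SET by apply/finset.setIidPr;
      rewrite finset.sub1set.
    by rewrite cards1 subrr.
  have bnC k : k \notin C -> b 0 (w k) = 0.
    move=> kC; have [i iC ikD] : exists2 i, i \in C & [set i;
      k]%SET \in faces Delta.
      apply: contrapT => nadj; move/negP: kC; apply.
      have <- : (k |: C = C)%SET; last by rewrite finset.setU11.
      apply: Cmax; last exact: finset.subsetUr.
      have nad i : i \in C -> [set i; k]%SET \notin faces Delta.
        by move=> iC; apply/negP => ik; apply: nadj; exists i.
      apply/forall_inP => i; rewrite !inE => /orP[/eqP->|iC];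
        apply/forall_inP => j; rewrite !inE => /orP[/eqP->|jC];
          apply/implyP => ij.
      + by rewrite eqxx in ij.
      + by rewrite finset.setUC nad.
      + exact: nad.
      + exact: Cind.
    have ik : i != k by apply: contraNneq kC => <-.
    have := bT (exist (fun F => F \in faces Delta) _ ikD);
      rewrite aP !dot_pointE /= big_setU1 ?inE //= big_set1.
    rewrite -/(w i) (bC i iC) addrAC addNr add0r => -> //.
    have -> : (C :&: [set i; k] = [set i])%SET.
      apply/finset.setP => j; rewrite !inE; case: (j =P i) => [->|];
        first by rewrite iC.
      by case: (j =P k) => [->|]; rewrite ?andbF // (negPf kC).
    by rewrite cards1 subrr.
  apply/rowP => i; rewrite mxE; have [->|[j ->]] := ord_widen_or_max i.
    by rewrite am mulr1.
  by rewrite aw; have [/bC->|/bnC->] := boolP (j \in C);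
    rewrite ?mulrN1 ?oppr0 ?mulr0.
- by exists (delta_mx 0 ord_max); rewrite dot_delta.
Qed.

End Lattice.

Local Open Scope classical_set_scope.

(** * Discrete valuations and symbolic powers *)

Lemma prime_idealP (R : comNzRingType) (P : set R) : prime_ideal P <->
  [/\ P 0, ~ P 1, forall a u v, P u -> P v -> P (a * u + v) &
      forall u v, P (u * v) -> P u \/ P v].
Proof.
rewrite /prime_ideal /ring_quotient.idealr_closed
  /ring_quotient.prime_idealr_closed.
split=> [[[P0 P1 PD] PM]|[P0 P1 PD PM]].
  split; first exact: set_mem.
  - by move=> /mem_set; apply/negP.
  - by move=> a u v /mem_set Pu /mem_set Pv; apply/set_mem/PD.
  - by move=> u v /mem_set/PM/orP[] /set_mem; [left|right].
split; [split=> [||a u v]|move=> u v].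
- exact: mem_set.
- by apply/negP => /set_mem.
- by move=> /set_mem Pu /set_mem Pv; apply/mem_set/PD.
- by move=> /set_mem/PM[] /mem_set ->; rewrite ?orbT.
Qed.

Section PrimeIdeal.
Variables (R : comNzRingType) (P : set R).
Hypothesis PP : prime_ideal P.

Lemma prime_ideal0 : P 0. Proof. by have /prime_idealP[] := PP. Qed.
Lemma prime_ideal1 : ~ P 1. Proof. by have /prime_idealP[] := PP. Qed.

Lemma prime_idealD u v : P u -> P v -> P (u + v).
Proof.
by move=> Pu; have /prime_idealP[_ _ /(_ 1 _ v Pu) h _] := PP;
  rewrite mul1r in h.
Qed.

Lemma prime_idealMr a u : P u -> P (a * u).
Proof.
by move=> Pu; have /prime_idealP[P0 _ /(_ a _ _ Pu P0) + _] := PP;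
  rewrite addr0.
Qed.

Lemma prime_idealM u v : P (u * v) -> P u \/ P v.
Proof. by have /prime_idealP[_ _ _] := PP; apply. Qed.

Lemma prime_idealX u k : P (u ^+ k) -> P u.
Proof.
elim: k => [/prime_ideal1//|k IHk]; rewrite exprS => /prime_idealM[]//.
Qed.

Lemma prime_ideal_prod (s : seq R) : P (\prod_(u <- s) u) ->
  exists2 u, u \in s & P u.
Proof.
elim: s => [|u s IHs]; first by rewrite big_nil => /prime_ideal1.
rewrite big_cons => /prime_idealM[Pu|/IHs[v vs Pv]].
  by exists u; rewrite ?mem_head.
by exists v; rewrite // inE vs orbT.
Qed.

End PrimeIdeal.

Lemma ideal_power_ideal (R : comNzRingType) (P : set R) k :
  [/\ ideal_power P k 0, forall u v, ideal_power P k u -> ideal_power P k v ->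
      ideal_power P k (u + v) &
      forall a u, ideal_power P k u -> ideal_power P k (a * u)].
Proof.
have I0 : ideal_power P k 0 by move=> A [[A0 _] _]; apply: set_mem.
have ID a u v : ideal_power P k u -> ideal_power P k v ->
  ideal_power P k (a * u + v).
  move=> Pu Pv A AP; case: (AP) => -[_ AD] _.
  by apply: set_mem; apply: AD; apply: mem_set; [apply: Pu|apply: Pv].
split=> // [u v Pu Pv|a u Pu]; first by have := ID 1 u v Pu Pv; rewrite mul1r.
by have := ID a u 0 Pu I0; rewrite addr0.
Qed.

Lemma ideal_power_expr (R : comNzRingType) (P : set R) k x :
  P x -> ideal_power P k (x ^+ k).
Proof.
move=> Px A [_]; apply; exists (fun=> x) => //.
by rewrite prodr_const card_ord.
Qed.

(** [W k] stands for [{f | v f >= k}], where [v] is a discrete valuation that is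
    nonnegative on [R]. The last field gives a uniformizer [x] and an element
      [s]
    of value 0 such that [f] is divisible by [x ^+ (v f)] once [s] is inverted.
    This makes the localization of [R] at the centre of [v] a discrete valuation
    ring, while avoiding to construct it. *)
Record valuation_filtration (R : idomainType) (W : nat -> R -> Prop) : Prop := {
  filtT : forall f, W 0%N f;
  filt0 : forall k, W k 0;
  filtD : forall k f g, W k f -> W k g -> W k (f + g);
  filtM : forall k l f g, W k f -> W l g -> W (k + l)%N (f * g);
  filt_unit : forall k s f, ~ W 1%N s -> W k (s * f) -> W k f;
  filt1 : ~ W 1%N 1;
  filt_sep : forall f, f != 0 -> exists k, ~ W k f;
  filt_param : exists s x, [/\ ~ W 1%N s, W 1%N x, x != 0 &
    forall k f, W k f -> exists N h, s ^+ N * f = x ^+ k * h]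
}.

Section Filtration.
Variables (R : idomainType) (W : nat -> R -> Prop).
Hypothesis WF : valuation_filtration W.

Lemma filt_mull k a f : W k f -> W k (a * f).
Proof.
by move=> h; rewrite -[k]add0n; apply: (filtM WF) => //; apply: filtT.
Qed.

Lemma filt_le k l f : (l <= k)%N -> W k f -> W l f.
Proof.
move=> /subnK <-; elim: (k - l)%N => // d IHd; rewrite addSn => h; apply: IHd.
have [s [x [sW xW _ param]]] := filt_param WF.
have [N [h' e]] := param _ _ h.
have unitX M g m : W m (s ^+ M * g) -> W m g.
  elim: M g => [|M IHM] g; first by rewrite mul1r.
  by rewrite exprSr -mulrA => /IHM /(filt_unit WF sW).
apply: (unitX N); rewrite e exprSr -mulrA.
elim: (d + l)%N => [|m IHm]; first exact: filtT.
by rewrite exprS -mulrA -[m.+1]add1n; apply: (filtM WF).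
Qed.

Lemma filt_prime : prime_ideal [set f | W 1 f].
Proof.
apply/prime_idealP; split=> /=; [exact: filt0|exact: filt1| |].
  by move=> a u v hu hv; apply: (filtD WF) => //; apply: filt_mull.
by move=> u v huv; have [hu|hu] := pselect (W 1 u); [left|right;
  apply: filt_unit huv].
Qed.

Lemma filt_order f : f != 0 -> exists2 k, W k f & ~ W k.+1 f.
Proof.
move=> f0; have ex : exists k, `[< ~ W k f >].
  by have [k kf] := filt_sep WF f0; exists k; apply/asboolP.
case: (ex_minnP ex) => -[|k] /asboolP nW kmin; first by case: nW; apply: filtT.
exists k => //; apply: contrapT => nk.
by have := kmin k (asboolT nk); rewrite ltnn.
Qed.

(** Up to factors outside of [W 1], an element of order [k] is [x ^+ k] and any
    element of [W 1] is a multiple of [x]; so a nonzero prime inside [W 1]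
    contains [x], and then all of [W 1]. *)
Lemma filt_height_one : height_one_prime [set f | W 1 f].
Proof.
have PP := filt_prime; have [s [x [sW xW x0 param]]] := filt_param WF.
split=> // [|Q QP QW].
  by apply: contra_neq x0 => e; have : [set f | W 1 f] x by []; rewrite e.
have [Q0|[f Qf f0]] : Q = [set 0] \/ exists2 f, Q f & f != 0.
  have [h|h] := pselect (exists2 f, Q f & f != 0); [by right|left].
  apply/seteqP; split=> [f Qf|_ ->]; last exact: prime_ideal0.
  by apply/eqP; apply: contrapT => /negP f0; apply: h; exists f.
  by left.
right; have sX N : ~ W 1 (s ^+ N) by move/(prime_idealX PP).
have [k kf nkf] := filt_order f0; have [N [h e]] := param _ _ kf.
have nh : ~ W 1 h.
  move=> h1; apply: nkf; apply: (filt_unit WF (sX N)).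
  rewrite e -addn1; apply: (filtM WF) => //.
  elim: k {kf e} => [|k IHk]; first exact: filtT.
  by rewrite exprS -add1n; apply: (filtM WF).
have Qx : Q x.
  apply: (prime_idealX QP (k := k)); have : Q (x ^+ k * h).
    by rewrite -e; apply: prime_idealMr.
  by case/(prime_idealM QP) => // /QW.
apply/seteqP; split=> // g /= g1; have [M [h' e']] := param _ _ g1.
have : Q (s ^+ M * g) by rewrite e' mulrC; apply: prime_idealMr.
by case/(prime_idealM QP) => // /QW/sX.
Qed.

Lemma filt_symbolic k f : symbolic_power [set f | W 1 f] k f <-> W k f.
Proof.
split=> [[s /= sW]|kf].
  suff h g : ideal_power [set f | W 1 f] k g ->
    W k g by move/h/(filt_unit WF sW).
  apply; split.
    split; first by apply: mem_set; exact: filt0.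
    move=> a u v /set_mem hu /set_mem hv; apply: mem_set.
    by apply: (filtD WF) => //; apply: filt_mull.
  move=> _ [a ah <-].
  have : forall i, W 1 (a i) by [].
  elim: k a {ah} => [|m IHm] a ah; first exact: filtT.
  rewrite big_ord_recl; exact: (filtM WF (ah ord0) (IHm _ (fun i => ah _))).
have [s [x [sW xW x0 param]]] := filt_param WF.
have [N [h e]] := param _ _ kf; exists (s ^+ N) => /=.
  by move/(prime_idealX filt_prime).
rewrite e mulrC; have [_ _] := ideal_power_ideal [set f | W 1 f] k; apply.
exact: ideal_power_expr.
Qed.

Lemma filt_has_order k f :
  has_order [set f | W 1 f] f k <-> W k f /\ ~ W k.+1 f.
Proof. by rewrite /has_order !filt_symbolic. Qed.

Lemma filt_order_unique k l f :
  W k f -> ~ W k.+1 f -> W l f -> ~ W l.+1 f -> k = l.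
Proof.
move=> hk nk hl nl; apply/eqP; rewrite eqn_leq; apply/andP; split;
  rewrite leqNgt.
  by apply/negP => lk; apply: nl; apply: filt_le hk.
by apply/negP => lk; apply: nk; apply: filt_le hl.
Qed.

End Filtration.

(** * Monomial valuations *)

Section Weights.
Variables (K : fieldType) (n : nat).
Implicit Types (L : 'rV[int]_n) (m : 'X_{1..n}) (p q : {mpoly K[n]}).

Definition mnm_row m : 'rV[int]_n := \row_i (m i)%:Z.

Lemma mnm_rowD m1 m2 : mnm_row (m1 + m2)%MM = mnm_row m1 + mnm_row m2.
Proof. by apply/rowP => i; rewrite !mxE mnmDE PoszD. Qed.

Lemma mnm_row0 : mnm_row 0%MM = 0.
Proof. by apply/rowP => i; rewrite !mxE mnm0E. Qed.

Lemma mnm_rowMn m k : mnm_row (m *+ k)%MM = mnm_row m *+ k.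
Proof.
by apply/rowP => i; rewrite mulmxnE !mxE mulmnE PoszM -mulr_natr natz.
Qed.

Lemma mnm_row_inj : injective mnm_row.
Proof.
by move=> m1 m2 /rowP e; apply/mnmP => i; have := e i; rewrite !mxE => -[].
Qed.

Lemma mnm_row_surj (v : 'rV[int]_n) : (forall i, 0 <= v 0 i) ->
  exists m, mnm_row m = v.
Proof.
move=> v0; exists [multinom absz (v 0%R i) | i < n]; apply/rowP => i.
by rewrite mxE mnmE gez0_abs.
Qed.

Definition weight L m : int := dot L (mnm_row m).

Lemma weightD L m1 m2 : weight L (m1 + m2)%MM = weight L m1 + weight L m2.
Proof. by rewrite /weight mnm_rowD dotDr. Qed.

Lemma weight0 L : weight L 0%MM = 0.
Proof. by rewrite /weight mnm_row0 dot0r. Qed.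

(** [p] is zero or has value at least [k] for the monomial valuation of [L]. *)
Definition wge L (k : int) p : Prop := forall m, m \in msupp p ->
  k <= weight L m.

Definition has_val L p (k : int) : Prop :=
  wge L k p /\ exists2 m, m \in msupp p & weight L m = k.

Lemma wge0 L k : wge L k 0.
Proof. by move=> m; rewrite msupp0. Qed.

Lemma wgeD L k p q : wge L k p -> wge L k q -> wge L k (p + q).
Proof.
by move=> hp hq m /msuppD_le; rewrite mem_cat => /orP[/hp|/hq].
Qed.

Lemma wgeM L k l p q : wge L k p -> wge L l q -> wge L (k + l) (p * q).
Proof.
move=> hp hq m /msuppM_le/allpairsP[[m1 m2] [/= /hp h1 /hq h2 ->]].
by rewrite weightD lerD.
Qed.

Lemma wge_le L k l p : k <= l -> wge L l p -> wge L k p.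
Proof. by move=> kl h m /h; apply: le_trans. Qed.

Lemma has_val_exists L p : p != 0 -> exists k, has_val L p k.
Proof.
rewrite -msupp_eq0; case ps: (msupp p) => [//|m0 s] _.
have m0p : m0 \in msupp p by rewrite ps mem_head.
case: (@arg_minP _ _ _ (Ordinal (isT : (0 < (size s).+1)%N)) xpredT
   (fun i : 'I_(size s).+1 => weight L (nth m0 (m0 :: s) i)) isT) => i _ imin.
exists (weight L (nth m0 (m0 :: s) i)); split; last first.
  by exists (nth m0 (m0 :: s) i); rewrite // ps mem_nth.
move=> m; rewrite ps => mp; have im :
  (index m (m0 :: s) < (size s).+1)%N by rewrite index_mem.
by have := imin (Ordinal im) isT; rewrite /= nth_index.
Qed.

Lemma has_val_neq0 L p k : has_val L p k -> p != 0.
Proof. by move=> [_ [m mp _]]; rewrite -msupp_eq0; case: (msupp p) mp. Qed.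

Lemma has_val_wge L p k l : has_val L p k -> wge L l p <-> l <= k.
Proof.
move=> [pk [m mp mk]]; split=> [h|lk]; first by rewrite -mk h.
exact: wge_le pk.
Qed.

Lemma has_val_unique L p k l : has_val L p k -> has_val L p l -> k = l.
Proof.
move=> hk hl; apply/eqP; rewrite eq_le; apply/andP; split.
  by apply/(has_val_wge _ hl); case: hk.
by apply/(has_val_wge _ hk); case: hl.
Qed.

(** [p0] is the initial form of [p], homogeneous of weight [k]. *)
Lemma has_val_split L p k : has_val L p k -> exists p0 p1,
  [/\ p = p0 + p1, p0 != 0, wge L k p0 /\ wge (- L) (- k) p0 & wge L (k + 1)
    p1].
Proof.
move=> [pk [m0 m0p m0k]].
pose part (P : pred int) : {mpoly K[n]} :=
  \sum_(m <- msupp p | P (weight L m)) p@_m *: 'X_[m].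
have partE P m : (part P)@_m = (P (weight L m))%:R * p@_m.
  rewrite raddf_sum /= [in RHS](mpolyE p) raddf_sum mulr_sumr /= big_mkcond.
  apply: eq_bigr => m' _; rewrite !mcoeffZ !mcoeffX.
  case: (m' =P m) => [->|_]; first by case: (P _); rewrite ?mul1r ?mul0r.
  by rewrite !mulr0 if_same.
have part_supp P m : m \in msupp (part P) -> m \in msupp p /\ P (weight L m).
  rewrite !mcoeff_msupp partE; case: (P _); rewrite ?mul1r // mul0r eqxx //.
exists (part (pred1 k)), (part (predC (pred1 k))); split.
- apply/mpolyP => m; rewrite mcoeffD !partE /= -mulrDl; case: (_ == _).
    by rewrite addr0 mul1r.
  by rewrite add0r mul1r.
- rewrite -msupp_eq0; suff : m0 \in msupp (part (pred1 k)) by case: msupp.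
  by rewrite mcoeff_msupp partE /= m0k eqxx mul1r -mcoeff_msupp.
- split=> m /part_supp[_ /= /eqP e]; first by rewrite e.
  by rewrite /weight dotNl -/(weight L m) e.
- move=> m /part_supp[mp /= mk]; rewrite lezD1 lt_neqAle eq_sym mk.
  exact: pk.
Qed.

(** The initial form of a product is the product of the initial forms, which is
    nonzero. *)
Lemma has_valM L p q k l : has_val L p k -> has_val L q l ->
  has_val L (p * q) (k + l).
Proof.
move=> hp hq; split; first by apply: wgeM; [case: hp|case: hq].
have [p0 [p1 [pE p00 [p0g p0l] p1g]]] := has_val_split hp.
have [q0 [q1 [qE q00 [q0g q0l] q1g]]] := has_val_split hq.
have : p0 * q0 != 0 by rewrite mulf_neq0.
rewrite -msupp_eq0; case e: (msupp (p0 * q0)) => [//|m s] _.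
have mpq : m \in msupp (p0 * q0) by rewrite e mem_head.
have mkl : weight L m = k + l.
  apply/eqP; rewrite eq_le (wgeM p0g q0g mpq) andbT.
  have := wgeM p0l q0l mpq; rewrite /weight dotNl.
  by rewrite -opprD lerN2.
exists m => //; rewrite mcoeff_msupp.
have rest : wge L (k + l + 1) (p * q - p0 * q0).
  have -> : p * q - p0 * q0 = p0 * q1 + (p1 * q0 + p1 * q1) by rewrite pE qE;
    ring.
  apply: wgeD; first by rewrite -addrA; apply: wgeM.
  apply: wgeD; first by rewrite addrAC; apply: wgeM.
  by apply: (@wge_le _ _ (k + 1 + (l + 1))); [lia|apply: wgeM].
rewrite -(subrK (p0 * q0) (p * q)) mcoeffD.
have /memN_msupp_eq0 -> : m \notin msupp (p * q - p0 * q0).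
  by apply/negP => /rest; rewrite mkl; lia.
by rewrite add0r -mcoeff_msupp.
Qed.

Lemma has_valC L (c : K) : c != 0 -> has_val L c%:MP 0.
Proof.
move=> c0; rewrite /has_val /wge msuppC (negPf c0); split=> [m|].
  by rewrite inE => /eqP->; rewrite weight0.
by exists 0%MM; rewrite ?mem_head ?weight0.
Qed.

Lemma has_valX L m : has_val L 'X_[m] (weight L m).
Proof.
rewrite /has_val /wge msuppX; split=> [m'|]; first by rewrite inE => /eqP->.
by exists m; rewrite ?mem_head.
Qed.

Definition wval L p : int := xget 0 [set k | has_val L p k].

Lemma wvalP L p : p != 0 -> has_val L p (wval L p).
Proof. by move=> /(has_val_exists L)[k hk]; apply: (xgetPex 0); exists k. Qed.

Lemma wval_eq L p k : has_val L p k -> wval L p = k.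
Proof.
by move=> hk; apply: has_val_unique (hk); apply: wvalP; apply: has_val_neq0 hk.
Qed.

Lemma wvalM L p q : p != 0 -> q != 0 -> wval L (p * q) = wval L p + wval L q.
Proof. by move=> p0 q0; apply: wval_eq; apply: has_valM; apply: wvalP. Qed.

Lemma wval_unit L p : p \is a GRing.unit -> wval L p = 0.
Proof.
case/andP=> /eqP pE; rewrite unitfE => c0; rewrite pE.
exact/wval_eq/has_valC.
Qed.

Lemma wvalX L m : wval L 'X_[m] = weight L m.
Proof. exact/wval_eq/has_valX. Qed.

Lemma wge_val L k p : p != 0 -> wge L k p <-> k <= wval L p.
Proof. by move=> p0; apply: has_val_wge; apply: wvalP. Qed.

Lemma wval_prod L (s : seq {mpoly K[n]}) : (forall p, p \in s -> p != 0) ->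
  wval L (\prod_(p <- s) p) = \sum_(p <- s) wval L p.
Proof.
elim: s => [|p s IHs] s0; first by rewrite !big_nil wval_unit ?unitr1.
have s0' q : q \in s -> q != 0 by move=> qs; rewrite s0 // inE qs orbT.
rewrite !big_cons wvalM ?IHs //; first by rewrite s0 ?mem_head.
by rewrite prodf_seq_neq0; apply/allP => q /s0'.
Qed.

End Weights.

(** * Multiplicities of prime factors *)

Section Multiplicity.
Variable D : idomainType.
Implicit Types (a b q : D) (s : seq D).

Definition has_mult q a k : Prop :=
  divides (q ^+ k) a /\ ~ divides (q ^+ k.+1) a.

Lemma has_multP q a k : q != 0 ->
  has_mult q a k <-> exists2 c, a = c * q ^+ k & ~ divides q c.
Proof.
move=> q0; split=> [[[c ->] nd]|[c -> nd]].
  by exists c => // -[e ce]; apply: nd; exists e; rewrite ce exprS mulrA.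
split=> [|[e ce]]; first by exists c.
apply: nd; exists e; apply: (mulIf (expf_neq0 k q0)).
by rewrite ce exprS mulrA.
Qed.

Lemma has_multM q a b k l : prime_elt q ->
  has_mult q a k -> has_mult q b l -> has_mult q (a * b) (k + l).
Proof.
move=> qP; have q0 := prime_neq0 qP; have [_ _ qM] := qP.
move=> /(has_multP _ _ q0)[c -> qc] /(has_multP _ _ q0)[d -> qd].
apply/(has_multP _ _ q0); exists (c * d); first by rewrite exprD mulrACA.
by case/qM.
Qed.

Lemma has_mult_unit q u : prime_elt q -> u \is a GRing.unit -> has_mult q u 0.
Proof.
move=> qP uU; split; first by exists u; rewrite mulr1.
by rewrite expr1; apply: prime_not_dvd_unit.
Qed.

Lemma has_mult_prime q p : prime_elt q -> prime_elt p ->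
  has_mult q p (`[< divides q p >] : bool).
Proof.
move=> qP pP; have q0 := prime_neq0 qP; apply/(has_multP _ _ q0).
case: asboolP => [qp|qp]; last by exists p; rewrite ?mulr1.
have [u uU ->] := prime_dvd_prime qP pP qp.
by exists u; rewrite ?expr1 //; apply: prime_not_dvd_unit.
Qed.

Lemma has_mult_prod q s : prime_elt q -> (forall p, p \in s -> prime_elt p) ->
  has_mult q (\prod_(p <- s) p) (\sum_(p <- s) (`[< divides q p >] : bool)).
Proof.
move=> qP; elim: s => [_|p s IHs sP]; rewrite ?big_nil ?big_cons.
  exact: has_mult_unit (unitr1 _).
apply: has_multM => //; first by apply: has_mult_prime => //; apply: sP;
  rewrite mem_head.
by apply: IHs => p' p's; apply: sP; rewrite inE p's orbT.
Qed.

End Multiplicity.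

Section PolyVariable.
Variables (K : fieldType) (n : nat) (i : 'I_n).

Lemma mnm_row1 (j : 'I_n) : mnm_row U_(j)%MM = delta_mx 0 j.
Proof.
by apply/rowP => k; rewrite !mxE mnm1E eq_sym; case: (_ == _).
Qed.

Lemma weight_delta (m : 'X_{1..n}) : weight (delta_mx 0 i) m = (m i)%:Z.
Proof. by rewrite /weight dotC dot_delta mxE. Qed.

Lemma divides_X (p : {mpoly K[n]}) : divides 'X_i p <-> wge (delta_mx 0 i) 1 p.
Proof.
split=> [[c ->]|h].
  rewrite -[1]add0r; apply: wgeM => m; first by rewrite weight_delta.
  by rewrite msuppX inE => /eqP->; rewrite weight_delta mnm1E eqxx.
exists (\sum_(m <- msupp p) p@_m *: 'X_[m - U_(i)]).
rewrite {1}(mpolyE p) mulr_suml; apply: eq_big_seq => m mp.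
rewrite -scalerAl -mpolyXD submK //; apply/mnm_lepP => j; rewrite mnm1E.
by case: eqP => // <-; have := h m mp; rewrite weight_delta lez_nat.
Qed.

(** Divisibility by a variable is a condition on weights, and weights add. *)
Lemma prime_X : prime_elt ('X_i : {mpoly K[n]}).
Proof.
have X0 : ('X_i : {mpoly K[n]}) != 0.
  by rewrite -msupp_eq0 msuppX.
split=> // [|a b].
  apply/negP => /(wval_unit (delta_mx 0 i)).
  by rewrite wvalX weight_delta mnm1E eqxx.
have [->|a0] := eqVneq a 0; first by left; exists 0; rewrite mul0r.
have [->|b0] := eqVneq b 0; first by right; exists 0; rewrite mul0r.
rewrite !divides_X !wge_val ?mulf_neq0 // wvalM // => h.
have pos (p : {mpoly K[n]}) : p != 0 -> 0 <= wval (delta_mx 0 i) p.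
  by move=> p0; apply/wge_val => // m _; rewrite weight_delta.
by have := pos a a0; have := pos b b0; lia.
Qed.

End PolyVariable.

(** * The toric ring and its height one primes *)

Section Toric.
Variables (K : fieldType) (n : nat) (Delta : simplicial_complex n).

Local Notation A := {mpoly K[n.+1]}.
Local Notation R := (toric_ring K Delta).
Local Notation t := ('X_ord_max : A).
Local Notation tR := (toric_t K Delta).
Local Notation in_monoid := (in_monoid Delta).
Local Notation facet_form := (facet_form Delta).

Lemma toric_genE (F : {set 'I_n}) :
  exists2 m, toric_gen K F = 'X_[m] & mnm_row m = lattice_point F.
Proof.
exists (\sum_(i in F) U_(widen_ord (leqnSn n) i) + U_(ord_max))%MM.
  rewrite /toric_gen mpolyXD; congr (_ * _).
  by rewrite (big_morph (@mpolyX _ K) (@mpolyXD _ K) (mpolyX0 _ K)).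
rewrite mnm_rowD /lattice_point.
rewrite (big_morph (@mnm_row _) (@mnm_rowD _) (mnm_row0 _)).
by congr (_ + _); [apply: eq_bigr => i _|]; rewrite mnm_row1.
Qed.

Lemma toric_predX m : in_monoid (mnm_row m) -> ('X_[m] :
  A) \in toric_pred Delta.
Proof.
move=> [c mE].
have /choice[g gE] (F : face_type Delta) : exists m' : 'X_{1..n.+1},
    toric_gen K (sval F) = 'X_[m'] /\ mnm_row m' = point F.
  by have [m' ? ?] := toric_genE (sval F); exists m'.
have -> : m = (\sum_F g F *+ c F)%MM.
  apply: mnm_row_inj; rewrite mE (big_morph (@mnm_row _) (@mnm_rowD _) (mnm_row0
    _)).
  by apply: eq_bigr => F _; rewrite mnm_rowMn; have [_ ->] := gE F.
rewrite (big_morph (@mpolyX _ K) (@mpolyXD _ K) (mpolyX0 _ K));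
  apply: rpred_prod => F _; rewrite -mpolyXn; apply: rpredX.
have [<- _] := gE F; apply/asboolP => B [_]; apply; exists (sval F) => //.
exact: (svalP F).
Qed.

Lemma toric_predP (p : A) : p \in toric_pred Delta <->
  forall m, m \in msupp p -> in_monoid (mnm_row m).
Proof.
split=> [/asboolP h|h].
  suff : [set q : A | forall m, m \in msupp q -> in_monoid (mnm_row m)] p by [].
  apply: h; split; last first.
    move=> _ [F FD <-] m; have [m' -> m'E] := toric_genE F.
    rewrite msuppX inE => /eqP->; rewrite m'E.
    exact: (in_monoid_point (exist (fun F => F \in faces Delta) F FD)).
  split=> [|a u v /set_mem hu /set_mem hv|u v /set_mem hu /set_mem hv];
    apply: mem_set => m.
  - by rewrite -mpolyC1 msuppC oner_eq0 inE => /eqP->; rewrite mnm_row0;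
    apply: in_monoid0.
  - by move/msuppD_le; rewrite mem_cat => /orP[/msuppZ_le/hu|/hv].
  - move=> /msuppM_le/allpairsP[[m1 m2] [/= /hu h1 /hv h2 ->]].
    by rewrite mnm_rowD; apply: in_monoidD.
have cl := @toric_pred_subalg K n Delta.
have [_ clZ _] := cl; rewrite (mpolyE p) big_seq; apply: rpred_sum => m mp.
by rewrite -[_ *: _]addr0; apply: clZ; [exact/toric_predX/h|exact: rpred0].
Qed.

Lemma toric_val1 : toric_val (1 : R) = 1. Proof. by []. Qed.
Lemma toric_valD (f g : R) : toric_val (f + g) = toric_val f + toric_val g.
Proof. by []. Qed.
Lemma toric_valM (f g : R) : toric_val (f * g) = toric_val f * toric_val g.
Proof. by []. Qed.
Lemma toric_valX (f : R) k : toric_val (f ^+ k) = toric_val f ^+ k.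
Proof. by elim: k => // k IHk; rewrite !exprS toric_valM IHk. Qed.
Lemma toric_val_inj : injective (@toric_val K n Delta). Proof. exact: val_inj.
  Qed.

Lemma toric_lift (p : A) : (forall m, m \in msupp p -> in_monoid (mnm_row m)) ->
  exists f : R, toric_val f = p.
Proof. by move=> /toric_predP h; exists (ToricElt h). Qed.

Lemma toric_supp (f : R) m : m \in msupp (toric_val f) -> in_monoid (mnm_row m).
Proof. by move: m; apply/toric_predP; case: f. Qed.

Lemma toric_liftX m : in_monoid (mnm_row m) -> exists f :
  R, toric_val f = 'X_[m].
Proof.
by move=> mS; apply: toric_lift => m'; rewrite msuppX inE => /eqP->.
Qed.

Lemma in_monoid_mnm v : in_monoid v -> exists m, mnm_row m = v.
Proof.
by move=> vS; apply: mnm_row_surj => i; apply: in_monoid_coord_ge0 vS.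
Qed.

(** Multiplying by [t] enough times brings any polynomial into the toric ring,
    because each [x_i t] and [t] are there. *)
Lemma toric_clear : exists (y : A -> R) (e : A -> nat),
  forall p, toric_val (y p) = t ^+ e p * p.
Proof.
suff h p : exists ye : R * nat, toric_val ye.1 = t ^+ ye.2 * p.
  by have [ye yeE] := choice h; exists (fun p => (ye p).1), (fun p => (ye p).2).
suff [N /toric_lift[f fE]] : exists N, forall m, m \in msupp (t ^+ N * p) ->
    in_monoid (mnm_row m) by exists (f, N).
exists (msize p) => m; rewrite mpolyXn => /msuppM_le/allpairsP[[m1 m2] [/=]].
rewrite msuppX inE => /eqP-> /msize_mdeg_lt m2p ->.
have -> : mnm_row (U_(ord_max) *+ msize p + m2)%MM =
    \sum_(i < n) point (face_vertex Delta i) *+ m2 (widen_ord (leqnSn n) i) +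
    point (face_empty Delta) *+ (msize p + m2 ord_max
      - \sum_(i < n) m2 (widen_ord (leqnSn n) i)).
  have sm : (\sum_(i < n) m2 (widen_ord (leqnSn n) i) <= msize p + m2
    ord_max)%N.
    move: m2p; rewrite mdegE big_ord_recr /=; lia.
  apply/rowP => k; rewrite !mxE mnmDE mulmnE mnm1E mulmxnE summxE.
  have [->|[j ->]] := ord_widen_or_max k.
    rewrite eqxx mul1n point_max -[_ *+ _]mulr_natr mul1r natz -subzn //.
    rewrite (eq_bigr (fun i => (m2 (widen_ord (leqnSn n) i))%:Z)).
      by rewrite -(big_morph Posz PoszD (erefl 0)) addrC subrK.
    by move=> i _; rewrite mulmxnE point_max natz.
  rewrite eq_sym widen_neq_max mul0n add0n point_coord inE mul0rn addr0.
  rewrite (bigD1 j) //= big1 ?addr0 => [|i ij]; rewrite mulmxnE point_coord inE.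
    by rewrite eqxx mulr1n natz.
  by rewrite eq_sym (negPf ij) mul0rn.
apply: in_monoidD; last exact/in_monoidMn/in_monoid_point.
by apply: in_monoid_sum => i _; exact/in_monoidMn/in_monoid_point.
Qed.

End Toric.

Section HeightOne.
Variables (K : fieldType) (n : nat) (Delta : simplicial_complex n).

Local Notation A := {mpoly K[n.+1]}.
Local Notation R := (toric_ring K Delta).
Local Notation t := ('X_ord_max : A).
Local Notation tR := (toric_t K Delta).
Local Notation in_monoid := (in_monoid Delta).
Local Notation facet_form := (facet_form Delta).

Lemma toric_tE : toric_val tR = t. Proof. by []. Qed.

Lemma toric_neq0 (f : R) : (toric_val f != 0) = (f != 0).
Proof. by rewrite -(inj_eq (@toric_val_inj K n Delta)). Qed.

Lemma t_neq0 : t != 0.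
Proof. by rewrite -msupp_eq0 msuppX. Qed.

Lemma tR_neq0 : tR != 0.
Proof. by rewrite -toric_neq0 t_neq0. Qed.

(** If [k v] is in the monoid then [x^v = (x^v t^N) / t^N] is a root of the
  monic
    polynomial [X^k - x^(k v)] over the toric ring. *)
Lemma normal_saturated : normal_domain R -> saturated Delta.
Proof.
move=> nR k v k0 kvS.
have [m mv] : exists m, mnm_row m = v.
  apply: mnm_row_surj => i; have := in_monoid_coord_ge0 i kvS.
  by rewrite mulmxnE pmulrn_lge0.
have [y [e yE]] := toric_clear K Delta.
have [c cE] : exists c : R, toric_val c = 'X_[m] ^+ k.
  by rewrite mpolyXn; apply: toric_liftX; rewrite mnm_rowMn mv.
have tN0 : tofrac (tR ^+ e 'X_[m]) != 0.
  by rewrite tofrac_eq0 expf_neq0 // tR_neq0.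
have [|r rE] := nR (tofrac (y 'X_[m]) / tofrac (tR ^+ e 'X_[m])).
  exists ('X^k - c%:P).
    rewrite monicE lead_coefDl ?lead_coefXn // size_polyXn.
    by rewrite size_polyN (leq_ltn_trans (size_polyC_leq1 _)).
  rewrite /root rmorphB /= map_polyXn map_polyC /= hornerD hornerN hornerXn
    hornerC.
  rewrite subr_eq0 expr_div_n; apply/eqP.
  rewrite -[RHS]mulr1 -(divff (expf_neq0 k tN0)) mulrA; congr (_ / _).
  rewrite -!tofracXn -tofracM; congr tofrac; apply: toric_val_inj.
  by rewrite toric_valM !toric_valX yE toric_tE cE exprMn mulrC.
have /(congr1 (@toric_val K n Delta)) : y 'X_[m] = r * tR ^+ e 'X_[m].
  by apply/eqP; rewrite -tofrac_eq tofracM -rE divfK.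
rewrite toric_valM toric_valX yE toric_tE mulrC.
move=> /(mulIf (expf_neq0 _ t_neq0)) rX.
by rewrite -mv; apply: (@toric_supp K n Delta r); rewrite -rX msuppX mem_head.
Qed.

Hypothesis satS : saturated Delta.

Definition facet_filt (a : 'rV[int]_n.+1) (k : nat) (f : R) : Prop :=
  wge a k%:Z (toric_val f).

Lemma weight_ge0 a m : facet_form a -> in_monoid (mnm_row m) -> 0 <= weight a m.
Proof. by move=> [_ a0 _ _]; apply: in_monoid_dot_ge0. Qed.

(** The uniformizer is a monomial [x^g] with [a g = 1], and the element to
    invert is the monomial of [facet_sum a]. *)
Lemma facet_filtration a : facet_form a -> valuation_filtration (facet_filt a).
Proof.
move=> aF; have pos f : facet_filt a 0 f by move=> m /toric_supp;
  apply: weight_ge0.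
split=> //.
- by move=> k; apply: wge0.
- by move=> k f g; apply: wgeD.
- by move=> k l f g hf hg; rewrite /facet_filt toric_valM PoszD; apply: wgeM.
- move=> k s f ns; rewrite /facet_filt toric_valM.
  have [->|f0] := eqVneq f 0; first by move=> _; apply: wge0.
  have s0 : toric_val s != 0.
    by apply: contra_notN ns => /eqP s0; rewrite /facet_filt s0; apply: wge0.
  rewrite !wge_val ?mulf_neq0 ?toric_neq0 // wvalM ?toric_neq0 //.
  suff -> : wval a (toric_val s) = 0 by rewrite add0r.
  apply/eqP; rewrite eq_le; apply/andP; split; last exact/wge_val/pos.
  by rewrite leNgt; apply/negP => s_gt0; apply: ns; apply/wge_val.
- rewrite /facet_filt toric_val1 wge_val ?oner_eq0 // wval_unit ?unitr1 //.
- move=> f f0; exists `|wval a (toric_val f)|.+1%N.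
  by rewrite /facet_filt wge_val ?toric_neq0 //; lia.
have [g gS ag] := facet_uniformizer satS aF.
have [mg mgE] := in_monoid_mnm gS.
have [mb mbE] := in_monoid_mnm (facet_sum_monoid Delta a).
have [x xE] := @toric_liftX K n Delta mg (eq_ind_r in_monoid gS mgE).
have [s sE] := @toric_liftX K n Delta mb (eq_ind_r in_monoid (facet_sum_monoid
  Delta a) mbE).
have wg : weight a mg = 1 by rewrite /weight mgE.
have wb : weight a mb = 0 by rewrite /weight mbE dot_facet_sum.
exists s, x; split.
- by rewrite /facet_filt sE => /(_ mb); rewrite msuppX mem_head wb => /(_ isT).
- by rewrite /facet_filt xE => m; rewrite msuppX inE => /eqP->; rewrite wg.
- by rewrite -toric_neq0 xE -msupp_eq0 msuppX.
move=> k f kf.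
(* One exponent [N] serves all the monomials of [f]. *)
have [N NP] : exists N, forall m, m \in msupp (toric_val f) ->
    in_monoid (mnm_row m - g *+ k + facet_sum Delta a *+ N).
  have /choice[N NP] m : exists N, m \in msupp (toric_val f) ->
      in_monoid (mnm_row m - g *+ k + facet_sum Delta a *+ N).
    have [mf|] := boolP (m \in msupp _); last by exists 0%N.
    have [|N h] := @facet_local n Delta a (mnm_row m - g *+ k) satS aF;
      last by exists N.
    by rewrite dotBr dotMnr ag subr_ge0 natz; apply: kf.
  exists (\sum_(m <- msupp (toric_val f)) N m)%N => m mf.
  rewrite (big_rem m) //= mulrnDr addrA; apply: in_monoidD; first exact: NP.
  exact/in_monoidMn/facet_sum_monoid.
have /choice[phi phiP] m : exists m', m \in msupp (toric_val f) ->
    mnm_row m' = mnm_row m - g *+ k + facet_sum Delta a *+ N.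
  have [mf|] := boolP (m \in msupp _); last by exists m.
  by have [m' m'E] := in_monoid_mnm (NP m mf); exists m'.
have [h hE] : exists h : R, toric_val h =
    \sum_(m <- msupp (toric_val f)) (toric_val f)@_m *: 'X_[phi m].
  apply: toric_lift => m /msupp_sum_le/flattenP[s' /mapP[m' m'f ->]].
  move/msuppZ_le; rewrite msuppX inE => /eqP->.
  move: m'f; rewrite mem_filter => /= m'f.
  by rewrite (phiP _ m'f); apply: NP.
exists N, h; apply: toric_val_inj;
  rewrite !toric_valM !toric_valX sE xE hE !mpolyXn.
rewrite {1}(mpolyE (toric_val f)) !mulr_sumr; apply: eq_big_seq => m mf.
rewrite -!scalerAr -!mpolyXD; congr (_ *: 'X_[_]); apply: mnm_row_inj.
by rewrite !mnm_rowD !mnm_rowMn mbE mgE phiP // [RHS]addrA [_ *+ k + _]addrC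
  subrK addrC.
Qed.

Definition facet_prime (a : 'rV[int]_n.+1) : set R :=
  [set f | facet_filt a 1 f].

Lemma facet_prime_X a m (f : R) : facet_form a -> toric_val f = 'X_[m] ->
  facet_prime a f <-> 0 < weight a m.
Proof.
move=> aF fE; rewrite /facet_prime /facet_filt /= fE; split=> [|h m'].
  by apply; rewrite msuppX mem_head.
by rewrite msuppX inE => /eqP->.
Qed.

Lemma facet_prime_t a : facet_form a -> facet_prime a tR.
Proof.
move=> aF; rewrite (facet_prime_X aF toric_tE) /weight mnm_row1 dot_delta.
by case: aF.
Qed.

Lemma facet_prime_sub a b : facet_form a -> facet_form b ->
  facet_prime a `<=` facet_prime b -> a = b.
Proof.
move=> aF bF ab; apply/esym/(facet_form_inj bF aF)/fintype.subsetP => F.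
rewrite !inE => /eqP bF0; apply/eqP.
have [m mE] := in_monoid_mnm (in_monoid_point F).
have [f fE] := @toric_liftX K n Delta m (eq_ind_r in_monoid (in_monoid_point F)
  mE).
have [_ a0 _ _] := aF; apply/eqP; rewrite eq_le a0 andbT leNgt;
  apply/negP => aF1.
have /ab : facet_prime a f by rewrite (facet_prime_X aF fE) /weight mE.
by rewrite (facet_prime_X bF fE) /weight mE bF0 ltxx.
Qed.

Variables (r : nat) (L : 'I_r -> 'rV[int]_n.+1).
Hypotheses (LF : forall j, facet_form (L j)) (Linj : injective L).
Hypothesis (Lsurj : forall a, facet_form a -> exists j, a = L j).

(** If [Q] contained no facet prime, it would avoid a monomial of each of them,
    and hence avoid the product of these monomials,
      which lies in the interior of
    the cone so that a power of it is divisible by [t]. *)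
Lemma prime_contains_facet (Q : set R) : prime_ideal Q -> Q tR ->
  exists j, facet_prime (L j) `<=` Q.
Proof.
move=> QP Qt; apply: contrapT => nQ.
have mono j : exists m (f : R), [/\ toric_val f = 'X_[m],
  0 < weight (L j) m & ~ Q f].
  apply: contrapT => nm; apply: nQ; exists j => f fj.
  have h m : m \in msupp (toric_val f) ->
      exists2 g : R, toric_val g = (toric_val f)@_m *: 'X_[m] & Q g.
    move=> mf; have [g gE] := @toric_liftX K n Delta m (toric_supp mf).
    have Qg : Q g by apply: contrapT => nQg; apply: nm; exists m, g; split=> //;
      apply: fj.
    have [c cE] : exists c : R, toric_val c = ((toric_val f)@_m)%:MP.
      apply: toric_lift => m'; rewrite msuppC; case: ifP => // _.
      by rewrite inE => /eqP->; rewrite mnm_row0; apply: in_monoid0.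
    exists (c * g); last exact: prime_idealMr.
    by rewrite toric_valM cE gE mul_mpolyC.
  have : forall s, {subset s <= msupp (toric_val f)} ->
      exists2 g : R, toric_val g = \sum_(m <- s) (toric_val f)@_m *: 'X_[m] & Q
        g.
    elim=> [_|m s IHs sf]; first by exists 0; rewrite ?big_nil //;
      apply: prime_ideal0.
    have [g gE Qg] := h m (sf m (mem_head _ _)).
    have [|g' gE' Qg'] := IHs; first by move=> m' m's; apply: sf;
      rewrite inE m's orbT.
    exists (g + g'); last exact: prime_idealD.
    by rewrite toric_valD gE gE' big_cons.
  move=> /(_ (msupp (toric_val f)) (fun _ => id))[g gE Qg].
  suff -> : f = g by [].
  by apply: toric_val_inj; rewrite gE -mpolyE.
have /choice[m] := mono => /choice[f fP].
pose w := (\sum_j m j)%MM.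
have wE : mnm_row w = \sum_j mnm_row (m j).
  by rewrite (big_morph (@mnm_row _) (@mnm_rowD _) (mnm_row0 _)).
have mS j : in_monoid (mnm_row (m j)).
  have [fE _ _] := fP j; apply: (toric_supp (f := f j)).
  by rewrite fE msuppX mem_head.
have wS : in_monoid (mnm_row w) by rewrite wE; apply: in_monoid_sum.
have wL a : facet_form a -> 0 < dot a (mnm_row w).
  move=> /Lsurj[j ->]; rewrite wE dot_sumr (bigD1 j) //=.
  have [_ fj _] := fP j; rewrite ltr_wpDr // sumr_ge0 // => i _.
  exact: weight_ge0.
have uc i : 0 <= (- delta_mx 0 ord_max :
  'rV[int]_n.+1) 0 (widen_ord (leqnSn n) i).
  by rewrite !mxE widen_neq_max andbF oppr0.
have [N NS] := interior_local satS wS wL uc.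
have [m' m'E] := in_monoid_mnm NS.
have [h hE] := @toric_liftX K n Delta m' (eq_ind_r in_monoid NS m'E).
have : Q ((\prod_j f j) ^+ N).
  suff -> : (\prod_j f j) ^+ N = h * tR by apply: prime_idealMr.
  apply: toric_val_inj; rewrite toric_valX toric_valM hE toric_tE.
  rewrite (big_morph (@toric_val K n Delta) (@toric_valM K n Delta) (toric_val1
    K Delta)).
  rewrite (eq_bigr (fun j => 'X_[m j])); last by move=> j _; have [] := fP j.
  rewrite -(big_morph (@mpolyX _ K) (@mpolyXD _ K) (mpolyX0 _ K)) -/w mpolyXn
    -mpolyXD.
  congr 'X_[_]; apply: mnm_row_inj.
  by rewrite mnm_rowMn mnm_rowD m'E mnm_row1 addrAC addNr add0r.
move/(prime_idealX QP); rewrite -(big_map f xpredT idfun).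
move/(prime_ideal_prod QP) => [_ /mapP[j _ ->]].
by have [] := fP j.
Qed.

Lemma facet_minimal_primes :
  minimal_primes (principal_ideal tR) = [set facet_prime (L j) | j in setT].
Proof.
have Qprime j := filt_prime (facet_filtration (LF j)).
have tsub (Q : set R) : prime_ideal Q -> (principal_ideal tR `<=` Q) <-> Q tR.
  move=> QP; split=> [|Qt _ [a _ <-]]; last exact: prime_idealMr.
  by apply; exists 1; rewrite ?mul1r.
apply/seteqP; split=> [P [PP /(tsub _ PP) Pt Pmin]|_ [j _ <-]].
  have [j jP] := prime_contains_facet PP Pt; exists j => //.
  by apply: Pmin => //; [exact: Qprime|apply/(tsub _ (Qprime j));
    exact: facet_prime_t].
split; [exact: Qprime|apply/(tsub _ (Qprime j)); exact: facet_prime_t|].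
move=> Q QP /(tsub _ QP) Qt Qj; have [i iQ] := prime_contains_facet QP Qt.
apply/seteqP; split=> //.
by rewrite -(facet_prime_sub (LF i) (LF j) (subset_trans iQ Qj)).
Qed.

(** The exponent 1 makes this the first step of [contraction_filt q] by
    conversion. *)
Definition contraction (q : A) : set R :=
  [set f | divides (q ^+ 1) (toric_val f)].

Definition contraction_filt (q : A) k (f : R) : Prop :=
  divides (q ^+ k) (toric_val f).

(** The uniformizer is a multiple [t ^+ N * q] lying in the toric ring, and
    [t] is the element to invert. *)
Lemma contraction_filtration q : prime_elt q -> ~ divides q t ->
  valuation_filtration (contraction_filt q).
Proof.
move=> qP qt; have q0 := prime_neq0 qP.
have [y [e yE]] := toric_clear K Delta.
split; rewrite /contraction_filt.
- by move=> f; exists (toric_val f); rewrite mulr1.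
- by move=> k; exists 0; rewrite mul0r.
- by move=> k f g; rewrite toric_valD; apply: dividesD.
- by move=> k l f g [c cE] [d dE]; exists (c * d);
  rewrite toric_valM cE dE exprD mulrACA.
- by move=> k s f; rewrite expr1 toric_valM; apply: prime_pow_cancel.
- by rewrite expr1; apply: prime_not_dvd_unit (unitr1 _).
- move=> f; rewrite -toric_neq0 => f0.
  have [u [s [uU sP ->]]] := factorial_mpoly f0.
  have [_] := has_multM qP (has_mult_unit qP uU) (has_mult_prod qP sP).
  by eexists; eassumption.
exists tR, (y q); split.
- by rewrite expr1 toric_tE.
- by rewrite expr1 yE; exists (t ^+ e q).
- by rewrite -toric_neq0 yE mulf_neq0 // expf_neq0 // t_neq0.
move=> k f [c cE]; exists (e q * k + e c)%N, (y c); apply: toric_val_inj.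
rewrite !toric_valM !toric_valX toric_tE cE !yE exprMn -exprM exprD; ring.
Qed.

Lemma contraction_dvd (p q : A) : prime_elt q -> ~ divides q t ->
  contraction p `<=` contraction q -> divides q p.
Proof.
move=> qP qt pq; have [y [e yE]] := toric_clear K Delta.
have /pq : contraction p (y p) by rewrite /contraction /= expr1 yE;
  exists (t ^+ e p).
rewrite /contraction /= yE => h; rewrite -[q]expr1.
apply: prime_pow_cancel h => // h; apply: qt; move: h.
elim: (e p) => [/(prime_not_dvd_unit qP (unitr1 _))//|N IHN].
by rewrite exprS; have [_ _ qM] := qP => /qM[].
Qed.

(** Factor a nonzero element of [P] in the polynomial ring. After multiplication
    by powers of [t], which is not in [P], the factors lie in the toric ring, so
    one of them, [q], has a multiple [t ^+ N * q] in [P]; then [P] contains the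
    contraction of [q], which is prime. *)
Lemma height_one_contraction (P : set R) : height_one_prime P -> ~ P tR ->
  exists q, [/\ prime_elt q, ~ divides q t & P = contraction q].
Proof.
move=> [PP Pn0 Pmin] Pt; have [y [e yE]] := toric_clear K Delta.
have tX k : ~ P (tR ^+ k) by move/(prime_idealX PP).
have [f Pf f0] : exists2 f, P f & f != 0.
  apply: contrapT => h; move/eqP: Pn0; apply.
  apply/seteqP; split=> [f Pf|_ ->]; last exact: prime_ideal0.
  by apply: contrapT => /eqP f0; apply: h; exists f.
have [u [s [uU sP fE]]] : exists u (s : seq A), [/\ u \is a GRing.unit,
    forall p, p \in s -> prime_elt p & toric_val f = u * \prod_(p <- s) p].
  by apply: factorial_mpoly; rewrite toric_neq0.
have [q qs Pq] : exists2 q, q \in s & P (y q).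
  suff : P (\prod_(z <- [seq y q | q <- s]) z).
    by move/(prime_ideal_prod PP) => [_ /mapP[q qs ->]]; exists q.
  suff : P (tR ^+ e u^-1 * \prod_(z <- [seq y q | q <- s]) z).
    by case/(prime_idealM PP) => // /tX.
  have -> : tR ^+ e u^-1 * \prod_(z <- [seq y q | q <- s]) z =
      tR ^+ (\sum_(q <- s) e q) * (y u^-1 * f).
    apply: toric_val_inj; rewrite !toric_valM !toric_valX toric_tE yE fE.
    rewrite big_map (big_morph (@toric_val K n Delta) (@toric_valM K n Delta)
      (toric_val1 K Delta)).
    rewrite [X in _ * X = _](eq_bigr (fun q => t ^+ e q * q)) => [|q _];
      last exact: yE.
    rewrite big_split /= -expr_sum -[t ^+ e u^-1 * _ * _]mulrA mulKr //.
    by rewrite mulrCA.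
  by rewrite mulrA; apply: prime_idealMr.
have qt : ~ divides q t.
  move=> [c tc]; apply: (tX (e c + e q).+1).
  suff -> : tR ^+ (e c + e q).+1 = y c * y q by apply: prime_idealMr.
  apply: toric_val_inj; rewrite toric_valM toric_valX !yE toric_tE.
  by rewrite mulrACA -tc exprSr exprD.
exists q; split=> //; first exact: sP.
have HF := contraction_filtration (sP q qs) qt.
case: (Pmin _ (filt_prime HF)) => [g /= [c gE]|e0|<- //].
  have : P (tR ^+ (e c + e q) * g).
    suff -> : tR ^+ (e c + e q) * g = y c * y q by apply: prime_idealMr.
    apply: toric_val_inj; rewrite !toric_valM toric_valX !yE toric_tE gE expr1.
    by rewrite mulrACA exprD.
  by case/(prime_idealM PP) => // /tX.
by have [_ /eqP] := filt_height_one HF.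
Qed.

Lemma height_one_facet (P : set R) : height_one_prime P -> P tR ->
  exists j, P = facet_prime (L j).
Proof.
move=> [PP Pn0 Pmin] Pt; have [j jP] := prime_contains_facet PP Pt; exists j.
have HF := facet_filtration (LF j).
case: (Pmin _ (filt_prime HF) jP) => // e0.
by have [_ /eqP] := filt_height_one HF.
Qed.

End HeightOne.

(** * Divisors and the class group *)

Lemma card_eq_range (T : Type) r (f : 'I_r -> T) : injective f ->
  ([set f j | j in [set: 'I_r]] #= `I_r)%card.
Proof.
move=> finj; apply: card_eq_trans (inj_card_eq (in2W finj)) _.
rewrite card_eq_sym; have <- : @nat_of_ord r @` setT = `I_r.
  by apply/seteqP; split=> [_ [j _ <-]|k kr];
    [exact: ltn_ord|exists (Ordinal kr)].
by apply: inj_card_eq => i j _ _; apply: val_inj.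
Qed.

Section PrincipalDivisors.
Variable R : idomainType.
Implicit Types D : divisor R.

Lemma principal_divisors0 : @principal_divisors R 0.
Proof. by have /asboolP := rpred0 (@principal_pred R). Qed.

Lemma principal_divisorsB D D' :
  principal_divisors D -> principal_divisors D' -> principal_divisors (D - D').
Proof.
by move=> hD hD'; apply/asboolP/(@rpredB _ (@principal_pred R)); apply/asboolP.
Qed.

Lemma principal_divisorsD D D' :
  principal_divisors D -> principal_divisors D' -> principal_divisors (D + D').
Proof.
by move=> hD hD'; apply/asboolP/(@rpredD _ (@principal_pred R)); apply/asboolP.
Qed.

Lemma principal_divisorsMz D k : principal_divisors D ->
  principal_divisors (D *~ k).
Proof.
by move=> hD; apply/asboolP/(@rpredMz _ (@principal_pred R))/asboolP.
Qed.

Lemma is_div_principal f D : f != 0 -> is_div f D -> principal_divisors D.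
Proof. by move=> f0 fD G [_]; apply; exists f. Qed.

(** Zero for a set [S] that is not a height one prime, so that the divisor can
    be written without a proof about [S]. *)
Definition prime_divisor (S : set R) : divisor R :=
  if pselect (height_one_prime S) is left h then
    << (exist (fun P => `[< height_one_prime P >]) S (asboolT h) :
      height_one R) >>
  else 0.

Lemma coeff_prime_divisor (P : height_one R) (S : set R) :
  coeff P (prime_divisor S) = (`[< val P = S >] : bool)%:R.
Proof.
rewrite /prime_divisor; case: pselect => [h|nh].
  rewrite coeffU mul1r; congr (_%:R); congr nat_of_bool.
  by apply/eqP/asboolP => [<-//|e]; apply: val_inj.
rewrite coeff0; case: asboolP => // e; case: nh; rewrite -e.
by case: P {e} => P /= /asboolP.
Qed.

Lemma prime_divisor_val (P : height_one R) : prime_divisor (val P) = << P >>.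
Proof.
apply/eqP/freeg_eqP => P'; rewrite coeff_prime_divisor coeffU mul1r.
congr (_%:R); congr nat_of_bool; apply/asboolP/eqP => [/val_inj->//|->//].
Qed.

Lemma height_one_val (P : height_one R) : height_one_prime (val P).
Proof. by case: P => P /= /asboolP. Qed.

End PrincipalDivisors.

Section ClassGroup.
Variables (K : fieldType) (n : nat) (Delta : simplicial_complex n).

Local Notation A := {mpoly K[n.+1]}.
Local Notation R := (toric_ring K Delta).
Local Notation t := ('X_ord_max : A).
Local Notation tR := (toric_t K Delta).
Local Notation facet_form := (facet_form Delta).
Local Notation contraction := (@contraction K n Delta).
Local Notation facet_prime := (@facet_prime K n Delta).

Hypothesis satS : saturated Delta.
Variables (r : nat) (L : 'I_r -> 'rV[int]_n.+1).
Hypotheses (LF : forall j, facet_form (L j)) (Linj : injective L).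
Hypothesis (Lsurj : forall a, facet_form a -> exists j, a = L j).

Lemma facet_prime_inj : injective (fun j => facet_prime (L j)).
Proof.
by move=> i j /= e; apply/Linj/(facet_prime_sub (K := K) (LF i) (LF j));
  rewrite e.
Qed.

Lemma facet_contraction_neq j q : ~ divides q t ->
  facet_prime (L j) <> contraction q.
Proof.
move=> qt e; apply: qt; rewrite -[q]expr1.
by have := facet_prime_t (K := K) (LF j); rewrite e.
Qed.

Lemma contraction_eq p q : prime_elt p -> prime_elt q -> ~ divides q t ->
  divides q p -> ~ divides p t /\ contraction p = contraction q.
Proof.
move=> pP qP qt qp; have [u uU pE] := prime_dvd_prime qP pP qp; split.
  by move=> pt; apply: qt; apply: divides_trans pt.
apply/seteqP; split=> f; rewrite /contraction /= !expr1;
  first exact: divides_trans.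
by move=> [c ->]; exists (c * u^-1); rewrite pE mulrA mulrVK.
Qed.

Lemma height_one_cases (P : height_one R) :
  (exists j, val P = facet_prime (L j)) \/
  (exists q, [/\ prime_elt q, ~ divides q t & val P = contraction q]).
Proof.
have PH := height_one_val P; have [Pt|Pt] := pselect (val P tR).
  by left; apply: height_one_facet PH Pt.
by right; apply: height_one_contraction PH Pt.
Qed.

Lemma has_order_unique (P : height_one R) f k l :
  has_order (val P) f k -> has_order (val P) f l -> k = l.
Proof.
have [[j ->]|[q [qP qt ->]]] := height_one_cases P.
  have HF := facet_filtration K satS (LF j).
  by move=> /(filt_has_order HF)[h1 h2] /(filt_has_order HF)[h3 h4];
    apply: (filt_order_unique HF) h1 h2 h3 h4.
have HF := contraction_filtration Delta qP qt.
by move=> /(filt_has_order HF)[h1 h2] /(filt_has_order HF)[h3 h4];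
  apply: (filt_order_unique HF) h1 h2 h3 h4.
Qed.

Lemma is_div_unique (f : R) D D' : is_div f D -> is_div f D' -> D = D'.
Proof.
move=> h h'; apply/eqP/freeg_eqP => P.
by have [k hk ->] := h P; have [l hl ->] := h' P;
  rewrite (has_order_unique hk hl).
Qed.

(** The divisor on the toric ring of a prime [p] of the polynomial ring, seen as
    an element of the common fraction field. A prime dividing [t] is associated
    with [t] and has no zero outside of those of [t]. *)
Definition factor_divisor (p : A) : divisor R :=
  (if `[< divides p t >] then 0 else prime_divisor (contraction p)) +
  \sum_j prime_divisor (facet_prime (L j)) *~ wval (L j) p.

Lemma coeff_factor_facet (P : height_one R) j p : val P = facet_prime (L j) ->
  coeff P (factor_divisor p) = wval (L j) p.
Proof.
move=> PE; rewrite /factor_divisor coeffD raddf_sum /= (bigD1 j) //= big1 => [|i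
  ij].
  rewrite addr0 raddfMz /= coeff_prime_divisor (asboolT PE) intz.
  case: asboolP => pt; first by rewrite coeff0 add0r.
  by rewrite coeff_prime_divisor asboolF ?add0r // PE;
    apply: facet_contraction_neq.
rewrite raddfMz /= coeff_prime_divisor asboolF ?mul0rz // PE => /facet_prime_inj
  e.
by rewrite e eqxx in ij.
Qed.

Lemma coeff_factor_contraction (P : height_one R) q p : prime_elt q ->
  ~ divides q t -> prime_elt p -> val P = contraction q ->
  coeff P (factor_divisor p) = (`[< divides q p >] : bool)%:R.
Proof.
move=> qP qt pP PE; rewrite /factor_divisor coeffD raddf_sum /= big1 ?addr0 =>
  [|i _].
  case: (asboolP (divides p t)) => pt.
    rewrite coeff0 asboolF // => qp; by case: (contraction_eq pP qP qt qp).
  rewrite coeff_prime_divisor PE; congr (_%:R); congr nat_of_bool.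
  apply/asboolP/asboolP => [e|qp].
    by apply: (@contraction_dvd K n Delta) => //; rewrite e.
  by have [_ ->] := contraction_eq pP qP qt qp.
rewrite raddfMz /= coeff_prime_divisor asboolF ?mul0rz // PE => e.
exact: (@facet_contraction_neq i q qt).
Qed.

(** Both kinds of valuations are defined on the polynomial ring and additive on
    products there, although the factors of [f] need not be in the toric ring.
      *)
Lemma is_div_factorization (f : R) u (s : seq A) : u \is a GRing.unit ->
  (forall p, p \in s -> prime_elt p) -> toric_val f = u * \prod_(p <- s) p ->
  is_div f (\sum_(p <- s) factor_divisor p).
Proof.
move=> uU sP fE P.
have prod0 : \prod_(p <- s) p != 0.
  by rewrite prodf_seq_neq0; apply/allP => p /sP/prime_neq0.
have u0 : u != 0 by apply: contraTneq uU => ->; rewrite unitr0.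
have f0 : toric_val f != 0 by rewrite fE mulf_neq0.
have [[j PE]|[q [qP qt PE]]] := height_one_cases P; rewrite PE raddf_sum /=.
  have HF := facet_filtration K satS (LF j).
  have vE : wval (L j) (toric_val f) = \sum_(p <- s) coeff P (factor_divisor p).
    rewrite fE wvalM // wval_unit // add0r wval_prod => [|p /sP/prime_neq0//].
    by apply: eq_bigr => p _; rewrite (coeff_factor_facet _ PE).
  have v0 : 0 <= wval (L j) (toric_val f) by apply/wge_val => //;
    exact: (filtT HF).
  exists (absz (wval (L j) (toric_val f))); last by rewrite gez0_abs.
  apply/(filt_has_order HF); rewrite /facet_filt !wge_val //; lia.
have HF := contraction_filtration Delta qP qt.
exists (\sum_(p <- s) (`[< divides q p >] : bool))%N.
  apply/(filt_has_order HF); rewrite /contraction_filt fE.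
  exact: has_multM (has_mult_unit qP uU) (has_mult_prod qP sP).
rewrite -[RHS]natz natr_sum; apply: eq_big_seq => p ps.
by rewrite (coeff_factor_contraction qP qt _ PE) //; apply: sP.
Qed.

Lemma principal_factor_t : principal_divisors (factor_divisor t).
Proof.
apply: (@is_div_principal R tR); first exact: tR_neq0.
have -> : factor_divisor t = \sum_(p <- [:: t]) factor_divisor p by rewrite
  big_seq1.
apply: (@is_div_factorization tR 1) => //.
- exact: unitr1.
- by move=> p; rewrite inE => /eqP->; apply: prime_X.
- by rewrite big_seq1 mul1r.
Qed.

(** A multiple [t ^+ N * p] is in the toric ring, and so is [t]. *)
Lemma principal_factor p : prime_elt p -> principal_divisors (factor_divisor p).
Proof.
move=> pP; have [y [e yE]] := toric_clear K Delta.
have : principal_divisors (\sum_(q <- p :: nseq (e p) t) factor_divisor q).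
  apply: (@is_div_principal R (y p)).
    by rewrite -toric_neq0 yE mulf_neq0 ?expf_neq0 ?t_neq0 ?prime_neq0.
  apply: (@is_div_factorization (y p) 1); first exact: unitr1.
    move=> q; rewrite inE => /orP[/eqP->//|/nseqP[-> _]]; exact: prime_X.
  by rewrite mul1r yE big_cons big_nseq iter_mulr_1 mulrC.
rewrite big_cons big_nseq iter_addr_0 => h.
rewrite -[factor_divisor p](addrK (factor_divisor t *~ e p)).
apply: principal_divisorsB; last by apply: principal_divisorsMz;
  apply: principal_factor_t.
by rewrite pmulrn in h.
Qed.

(** The orders of [t] along the facet primes, see [wval_t]. *)
Definition t_values : 'rV[int]_r := \row_j L j 0 ord_max.

Lemma wval_t j : wval (L j) t = L j 0 ord_max.
Proof. by rewrite wvalX /weight mnm_row1 dot_delta. Qed.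

Lemma factor_divisor_dvd_t p : prime_elt p -> divides p t ->
  factor_divisor p = \sum_j prime_divisor (facet_prime (L j)) *~ L j 0 ord_max.
Proof.
move=> pP pt; rewrite /factor_divisor asboolT // add0r; apply: eq_bigr => j _.
have [u uU tE] := prime_dvd_prime pP (prime_X K ord_max) pt.
have u0 : u != 0 by apply: contraTneq uU => ->; rewrite unitr0.
by rewrite -wval_t tE wvalM ?(prime_neq0 pP) // (wval_unit _ uU) add0r.
Qed.

Definition generator (P : set R) : A :=
  xget 0 [set q | [/\ prime_elt q, ~ divides q t & P = contraction q]].

(** The facet primes are sent to the unit vectors; the contraction of a prime
    [q] is then sent to the vector for which the divisor of [q] has image 0. *)
Definition class_map (P : height_one R) : 'rV[int]_r :=
  \row_j if `[< val P tR >] then (`[< val P = facet_prime (L j) >] : bool)%:R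
         else - wval (L j) (generator (val P)).

Definition class_vector : divisor R -> 'rV[int]_r := fglift class_map.

Lemma class_vectorB : {morph class_vector : D D' / D - D'}.
Proof. exact: lift_is_additive. Qed.

Lemma class_vector0 : class_vector 0 = 0.
Proof. by rewrite -[0 in LHS](subrr 0) class_vectorB subrr. Qed.

Lemma class_vectorD : {morph class_vector : D D' / D + D'}.
Proof.
move=> D D'; rewrite -[D' in LHS]opprK class_vectorB.
by rewrite -[- D']sub0r class_vectorB class_vector0 sub0r opprK.
Qed.

Lemma class_vectorU k P : class_vector << k *g P >> = k *: class_map P.
Proof. exact: liftU. Qed.

Lemma class_vectorMz D k : class_vector (D *~ k) = k *: class_vector D.
Proof.
have cn m : class_vector (D *+ m) = class_vector D *+ m.
  by elim: m => [|m IHm]; rewrite ?class_vector0 // !mulrS class_vectorD IHm.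
have sz m (v : 'rV[int]_r) : m%:Z *: v = v *+ m by rewrite -[m%:Z]natz
  scaler_nat.
case: k => m; first by rewrite -[D *~ _]/(D *+ m) cn sz.
rewrite NegzE mulrNz -[- _]sub0r class_vectorB class_vector0 sub0r scaleNr.
by rewrite -[D *~ _]/(D *+ m.+1) cn sz.
Qed.

Lemma class_vector_sum I (s : seq I) (F : I -> divisor R) :
  class_vector (\sum_(i <- s) F i) = \sum_(i <- s) class_vector (F i).
Proof. exact: (big_morph _ class_vectorD class_vector0). Qed.

Lemma class_vector_facet j :
  class_vector (prime_divisor (facet_prime (L j))) = delta_mx 0 j.
Proof.
have H := filt_height_one (facet_filtration K satS (LF j)).
pose P : height_one R := exist (fun P => `[< height_one_prime P >]) _ (asboolT
  H).
have PE : val P = facet_prime (L j) by [].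
rewrite -PE prime_divisor_val class_vectorU scale1r; apply/rowP => i.
rewrite !mxE asboolT; last exact: (facet_prime_t (LF j)).
rewrite eqxx /=; congr (_%:R); congr nat_of_bool.
by apply/asboolP/eqP => [/facet_prime_inj->//|->].
Qed.

Lemma generatorP q : prime_elt q -> ~ divides q t ->
  [/\ prime_elt (generator (contraction q)),
    ~ divides (generator (contraction q)) t
    & contraction q = contraction (generator (contraction q))].
Proof.
move=> qP qt; apply: (xgetPex 0 (P := [set p | [/\ prime_elt p, ~ divides p t &
  contraction q = contraction p]])); by exists q.
Qed.

Lemma class_vector_contraction q : prime_elt q -> ~ divides q t ->
  class_vector (prime_divisor (contraction q)) = - \row_j wval (L j) q.
Proof.
move=> qP qt.
have H := filt_height_one (contraction_filtration Delta qP qt).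
pose P : height_one R := exist (fun P => `[< height_one_prime P >]) _ (asboolT
  H).
have PE : val P = contraction q by [].
rewrite -PE prime_divisor_val class_vectorU scale1r; apply/rowP => j.
have [gP gt gE] := generatorP qP qt.
rewrite !mxE asboolF PE; last by rewrite /contraction /= expr1.
have gq : divides (generator (contraction q)) q.
  by apply: (@contraction_dvd K n Delta) => //; rewrite -gE.
have [u uU {2}->] := prime_dvd_prime gP qP gq.
have u0 : u != 0 by apply: contraTneq uU => ->; rewrite unitr0.
by rewrite wvalM ?(prime_neq0 gP) // (wval_unit _ uU) add0r.
Qed.

Lemma class_vector_facets (v : 'I_r -> int) :
  class_vector (\sum_j prime_divisor (facet_prime (L j)) *~ v j) = \row_j v j.
Proof.
rewrite class_vector_sum [RHS]row_sum_delta; apply: eq_bigr => j _.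
by rewrite class_vectorMz class_vector_facet mxE.
Qed.

Lemma class_vector_factor p : prime_elt p ->
  exists k, class_vector (factor_divisor p) = k *: t_values.
Proof.
move=> pP; have [pt|pt] := pselect (divides p t).
  by exists 1; rewrite factor_divisor_dvd_t // class_vector_facets scale1r.
exists 0; rewrite /factor_divisor asboolF // class_vectorD class_vector_facets.
by rewrite class_vector_contraction // addNr scale0r.
Qed.

(** By unique factorization and [is_div_unique], the divisor of an element is a
    sum of divisors of factors, which have image 0 except for the factors
    associated with [t]. *)
Lemma class_vector_principal D : principal_divisors D ->
  exists k, class_vector D = k *: t_values.
Proof.
pose G : set (divisor R) := [set D | exists k, class_vector D = k *: t_values].
suff h : principal_divisors D -> G D by exact: h.
apply; split.
  split=> [|x y /set_mem[k xk] /set_mem[l yl]]; apply: mem_set.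
    by exists 0; rewrite class_vector0 scale0r.
  by exists (k - l); rewrite class_vectorB xk yl scalerBl.
move=> {}D [f f0 fD].
have [u [s [uU sP fE]]] : exists u (s : seq A), [/\ u \is a GRing.unit,
    forall p, p \in s -> prime_elt p & toric_val f = u * \prod_(p <- s) p].
  by apply: factorial_mpoly; rewrite toric_neq0.
rewrite (is_div_unique fD (is_div_factorization uU sP fE)) {fE}.
elim: s sP => [_|p s IHs sP]; first by exists 0;
  rewrite big_nil class_vector0 scale0r.
have [|k kE] := class_vector_factor (p := p); first by apply: sP;
  rewrite mem_head.
have [|l lE] := IHs; first by move=> q qs; apply: sP; rewrite inE qs orbT.
by exists (k + l); rewrite big_cons class_vectorD kE lE scalerDl.
Qed.

(** Nagata: modulo the divisors of the primes [q], every divisor is a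
    combination of facet primes. *)
Lemma principal_reduction D : principal_divisors
  (D - \sum_j prime_divisor (facet_prime (L j)) *~ class_vector D 0 j).
Proof.
elim/freeg_ind_dom0: D => [|k P D _ _ IHD].
  rewrite big1 => [|j _]; first by rewrite subr0; apply: principal_divisors0.
  by rewrite class_vector0 mxE mulr0z.
have kP : << k *g P >> = << P >> *~ k :> divisor R by rewrite freeg_mulz intz.
have -> : << k *g P >> + D - \sum_j prime_divisor (facet_prime (L j)) *~
      class_vector (<< k *g P >> + D) 0 j =
   (<< P >> - \sum_j prime_divisor (facet_prime (L j)) *~ class_vector << P >> 0
     j) *~ k
   + (D - \sum_j prime_divisor (facet_prime (L j)) *~ class_vector D 0 j).
  rewrite mulrzBl -kP addrACA -opprD; congr (_ - _).
  rewrite mulrz_suml -big_split; apply: eq_bigr => j _ /=.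
  by rewrite class_vectorD kP class_vectorMz !mxE mulrzDr [k * _]mulrC mulrzA.
apply: principal_divisorsD => //; apply: principal_divisorsMz.
have [[j PE]|[q [qP qt PE]]] := height_one_cases P;
  rewrite -prime_divisor_val PE.
  rewrite class_vector_facet (bigD1 j) //= big1 => [|i ij].
    by rewrite mxE !eqxx addr0 subrr; apply: principal_divisors0.
  by rewrite mxE (negPf ij) andbF.
rewrite class_vector_contraction //.
have := principal_factor qP; rewrite /factor_divisor asboolF //.
rewrite -sumrN; congr (principal_divisors (_ + _)); apply: eq_bigr => j _.
by rewrite !mxE mulrNz opprK.
Qed.

Lemma principal_class_vector D k : class_vector D = k *: t_values ->
  principal_divisors D.
Proof.
move=> Dk; rewrite -[D](subrK (\sum_j prime_divisor (facet_prime (L j)) *~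
  class_vector D 0 j)).
apply: principal_divisorsD; first exact: principal_reduction.
have -> : \sum_j prime_divisor (facet_prime (L j)) *~ class_vector D 0 j =
    factor_divisor t *~ k.
  rewrite factor_divisor_dvd_t; [|exact: prime_X|exact: divides_refl].
  rewrite mulrz_suml; apply: eq_bigr => j _.
  by rewrite Dk !mxE mulrC mulrzA.
by apply: principal_divisorsMz; apply: principal_factor_t.
Qed.

End ClassGroup.

Section FreeClassGroup.
Variables (K : fieldType) (n : nat) (Delta : simplicial_complex n).
Local Notation R := (toric_ring K Delta).
Local Notation facet_prime := (@facet_prime K n Delta).

Hypothesis satS : saturated Delta.
Variables (r : nat) (L : 'I_r.+1 -> 'rV[int]_n.+1).
Hypotheses (LF : forall j, facet_form Delta (L j)) (Linj : injective L).
Hypothesis (Lsurj : forall a, facet_form Delta a -> exists j, a = L j).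
Variable j0 : 'I_r.+1.
Hypothesis Lj0 : L j0 0 ord_max = 1.

(** The projection of [Z^(r+1)] along [t_values], onto the coordinates other
    than [j0]; it is defined over the integers because [t_values] has coordinate
    1 at [j0]. *)
Definition mod_t_values (v : 'rV[int]_r.+1) : 'rV[int]_r :=
  \row_i (v 0 (fintype.lift j0 i) - v 0 j0 * L (fintype.lift j0 i) 0 ord_max).

Lemma mod_t_valuesB u v : mod_t_values (u - v) = mod_t_values u - mod_t_values
  v.
Proof. by apply/rowP => i; rewrite !mxE; ring. Qed.

Lemma mod_t_values_eq0 v : mod_t_values v = 0 <-> exists k, v = k *: t_values L.
Proof.
split=> [/rowP h|[k ->]]; last first.
  by apply/rowP => i; rewrite !mxE Lj0; ring.
exists (v 0 j0); apply/rowP => i; rewrite !mxE.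
have [->|[i' ->]] : i = j0 \/ exists i', i = fintype.lift j0 i'.
  by case: (unliftP j0 i) => [i' ->|->]; [right; exists i'|left].
by rewrite Lj0 mulr1.
by have := h i'; rewrite !mxE => /eqP; rewrite subr_eq0 => /eqP.
Qed.

Definition class_iso (x : class_group R) : 'rV[int]_r :=
  mod_t_values (class_vector L (repr x)).

Lemma class_iso_pi D : class_iso (\pi_(class_group R)%qT D) = mod_t_values
  (class_vector L D).
Proof.
apply/eqP; rewrite -subr_eq0 /class_iso -mod_t_valuesB -class_vectorB;
  apply/eqP.
apply/mod_t_values_eq0/(class_vector_principal satS LF Linj Lsurj)/asboolP.
have /eqP := reprK (\pi_(class_group R)%qT D).
by rewrite -Quotient.idealrBE.
Qed.

Lemma class_isoB : {morph class_iso : x y / x - y}.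
Proof.
elim/quotW => x; elim/quotW => y.
have piB : (\pi_(class_group R) (x - y) = \pi_(class_group R) x -
  \pi_(class_group R) y)%qT.
  exact: (raddfB \pi_({ideal_quot (@principal_pred R :
    zmodClosed (divisor R))})%qT).
by rewrite -piB !class_iso_pi class_vectorB mod_t_valuesB.
Qed.

Lemma class_group_free : free_of_rank (class_group R) r.
Proof.
pose h := GRing.isZmodMorphism.Build _ _ class_iso class_isoB.
pose f : {additive class_group R -> 'rV[int]_r} := HB.pack class_iso h.
exists f; pose g (w : 'rV[int]_r) : class_group R := \pi_(class_group R)%qT
  (\sum_j prime_divisor (facet_prime (L j)) *~
     (if unlift j0 j is Some i then w 0 i else 0)).
have fg : cancel g f.
  move=> w; rewrite -[f _]/(class_iso _) class_iso_pi class_vector_facets //.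
  by apply/rowP => i; rewrite !mxE liftK unlift_none mul0r subr0.
exists g => //; elim/quotW => D.
apply/eqP; rewrite -Quotient.idealrBE.
set D' := \sum_j _ ; apply/asboolP.
have [k kE] : exists k, class_vector L (D' - D) = k *: t_values L.
  apply/mod_t_values_eq0; rewrite class_vectorB mod_t_valuesB.
  by rewrite -!class_iso_pi; apply/eqP; rewrite subr_eq0; apply/eqP; exact: fg.
exact: (principal_class_vector satS LF Linj Lsurj kE).
Qed.

End FreeClassGroup.

(** * Facets of the real cone *)

Section RealFacets.
Variables (n : nat) (Delta : simplicial_complex n).
Implicit Types (T : {set face_type Delta}).

Definition span_mx (F : fieldType) T : 'M[F]_(#|face_type Delta|, n.+1) :=
  \matrix_i (if enum_val i \in T then map_mx intr (point (enum_val i)) else 0).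

Definition vanishes_on (F : fieldType) T (b : 'rV[F]_n.+1) : Prop :=
  forall G, G \in T -> dot b (map_mx intr (point G)) = 0.

Lemma vanishes_onP (F : fieldType) T (b : 'rV[F]_n.+1) :
  vanishes_on T b <-> (b <= kermx (span_mx F T)^T)%MS.
Proof.
have mE i : (b *m (span_mx F T)^T) 0 i = dot b (row i (span_mx F T)).
  by rewrite mxE; apply: eq_bigr => j _; rewrite !mxE.
split=> [h|/sub_kermxP h G GT].
  apply/sub_kermxP/rowP => i; rewrite mE rowK mxE.
  by case: ifP => [/h//|_]; rewrite dot0r.
by have := mE (enum_rank G); rewrite h mxE rowK enum_rankK GT => ->.
Qed.

Lemma span_mx_kernel (F : fieldType) T :
  \rank (kermx (span_mx F T)^T) = (n.+1 - \rank (span_mx F T))%N.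
Proof. by rewrite mxrank_ker mxrank_tr. Qed.

Lemma span_mx_full (F : fieldType) :
  \rank (span_mx F [set: face_type Delta]%SET) = n.+1.
Proof.
have : \rank (kermx (span_mx F [set: face_type Delta]%SET)^T) = 0%N.
  apply/eqP; rewrite mxrank_eq0; apply/eqP/row_matrixP => i; rewrite row0.
  apply: points_span => G; have /vanishes_onP :
    (row i (kermx (span_mx F [set: face_type Delta]%SET)^T) <=
    kermx (span_mx F [set: face_type Delta]%SET)^T)%MS by apply: row_sub.
  by apply; rewrite inE.
by rewrite span_mx_kernel => /eqP; rewrite subn_eq0 => h; apply/eqP;
  rewrite eqn_leq h rank_leq_col.
Qed.

Lemma span_mx_hyperplane (F : fieldType) T (a : 'rV[F]_n.+1) : a != 0 ->
  vanishes_on T a ->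
  (\rank (span_mx F T) = n <->
   forall b : 'rV[F]_n.+1, vanishes_on T b -> exists l, b = l *: a).
Proof.
move=> a0 aT; have ak := (vanishes_onP T a).1 aT.
have ra : \rank a = 1%N by rewrite rank_rV a0.
have [_ aE] := mxrank_leqif_sup ak.
have rk := span_mx_kernel F T; have rn := rank_leq_col (span_mx F T).
have r1 : (1 <= \rank (kermx (span_mx F T)^T))%N by rewrite -ra; apply: mxrankS.
split=> [e b /vanishes_onP bk|h].
  have ka : (kermx (span_mx F T)^T <= a)%MS by rewrite -aE ra rk e subSnn.
  by apply/sub_rVP/(submx_trans bk).
suff : \rank (kermx (span_mx F T)^T) = 1%N by lia.
rewrite -ra; apply/eqP; rewrite eq_sym aE; apply/row_subP => i.
by apply/sub_rVP; apply: h; apply/vanishes_onP/row_sub.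
Qed.

Lemma map_span_mx (F : numFieldType) T :
  span_mx F T = map_mx ratr (span_mx rat T).
Proof.
apply/matrixP => i j; rewrite !mxE; case: ifP => _; rewrite !mxE ?rmorph0 //.
by rewrite rmorph_int.
Qed.

(** Dimensions of faces can be computed over the rationals. *)
Lemma rank_span_mx (F : numFieldType) T :
  \rank (span_mx F T) = \rank (span_mx rat T).
Proof. by rewrite map_span_mx mxrank_map. Qed.

Lemma facet_form_rank (a : 'rV[int]_n.+1) : facet_form Delta a ->
  \rank (span_mx rat (vanishing Delta a)) = n.
Proof.
move=> [a0 _ aker _].
have aQ : map_mx intr a != 0 :> 'rV[rat]_n.+1.
  apply: contraTneq a0 => /rowP/(_ ord_max); rewrite !mxE => /eqP.
  by rewrite intr_eq0 => /eqP->; rewrite ltxx.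
apply/(span_mx_hyperplane aQ) => [G|b bT].
  by rewrite inE dot_map => /eqP->.
have [k k0 /choice[z zE]] := common_denominator (b 0).
have zk : map_mx intr (\row_i z i) = k%:R *: b.
  by apply/rowP => i; rewrite !mxE zE.
have kQ : k%:R != 0 :> rat by rewrite pnatr_eq0 -lt0n.
have /(congr1 (map_mx (intr : int -> rat))) :
  a 0 ord_max *: (\row_i z i) = (\row_i z i) 0 ord_max *: a.
  apply: aker => G aG; apply: (@intr_inj rat); rewrite -dot_map zk dotZl.
  by rewrite bT ?mulr0 // inE aG.
rewrite !map_mxZ zk => e.
exists (((\row_i z i) 0 ord_max)%:~R / ((a 0 ord_max)%:~R * k%:R)).
have aQ0 : (a 0 ord_max)%:~R != 0 :> rat by rewrite intr_eq0 gt_eqF.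
apply: (scalerI (a := (a 0 ord_max)%:~R * k%:R)); first by rewrite mulf_neq0.
by rewrite scalerA mulrCA divff ?mulf_neq0 // mulr1 -e scalerA.
Qed.

Variable RR : realType.
Local Notation C := (cone_over RR (toric_semigroup Delta)).
Local Notation pointR G := (map_mx intr (@point n Delta G) : 'rV[RR]_n.+1).

Lemma toric_semigroup_monoid p : toric_semigroup Delta p -> in_monoid Delta p.
Proof.
suff h : toric_semigroup Delta p -> [set q | in_monoid Delta q] p by exact: h.
apply; split; last by move=> _ [F FD <-];
  exact: (in_monoid_point (exist (fun F => F \in faces Delta) F FD)).
split=> [|x y /set_mem hx /set_mem hy]; apply: mem_set; first exact: in_monoid0.
exact: in_monoidD.
Qed.

Lemma cone_overP y : C y <->
  exists2 c : face_type Delta ->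
    RR, forall G, 0 <= c G & y = \sum_G c G *: pointR G.
Proof.
split=> [h|[c c0 ->] B [[[B0 BD] BZ] BS]].
  suff : [set y | exists2 c : face_type Delta -> RR, forall G, 0 <= c G &
    y = \sum_G c G *: pointR G] y by [].
  apply: h; split; last first.
    move=> _ [p /toric_semigroup_monoid[c ->] <-].
    exists (fun G => (c G)%:R) => //; rewrite raddf_sum; apply: eq_bigr => G _.
    by rewrite raddfMn /= scaler_nat.
  split; first split=> [|_ _ /set_mem[c c0 ->] /set_mem[d d0 ->]];
    first apply: mem_set.
  - by exists (fun=> 0) => //; rewrite big1 // => G _; rewrite scale0r.
  - apply: mem_set; exists (fun G => c G + d G) => [G|];
    first by rewrite addr_ge0.
    by rewrite -big_split; apply: eq_bigr => G _; rewrite scalerDl.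
  move=> k _ k0 [c c0 ->]; exists (fun G => k * c G) => [G|];
    first by rewrite mulr_ge0.
  by rewrite scaler_sumr; apply: eq_bigr => G _; rewrite scalerA.
apply: set_mem; apply: (big_ind (fun v => v \in B) B0 BD) => G _.
apply: mem_set; apply: BZ => //; apply: BS; exists (point G) => //.
by move=> S [_]; apply; exists (val G) => //; exact: (valP G).
Qed.

Lemma cone_point G : C (pointR G).
Proof.
apply/cone_overP; exists (fun H => (H == G)%:R) => [H|]; first exact: ler0n.
rewrite (bigD1 G) //= eqxx scale1r big1 ?addr0 // => H /negPf->.
by rewrite scale0r.
Qed.

Lemma cone_ge0 (a y : 'rV[RR]_n.+1) : (forall G :
  face_type Delta, 0 <= dot a (pointR G)) -> C y -> 0 <= dot a y.
Proof.
move=> h /cone_overP[c c0 ->]; rewrite dot_sumr sumr_ge0 // => G _.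
by rewrite dotZr mulr_ge0.
Qed.

Definition facet_of (a : 'rV[RR]_n.+1) : set 'rV[RR]_n.+1 :=
  C `&` [set y | dotr a y = 0].

Lemma facet_of_span (a y : 'rV[RR]_n.+1) : (forall G :
  face_type Delta, 0 <= dot a (pointR G)) -> facet_of a y ->
  (y <= span_mx RR [set G : face_type Delta | dot a (pointR G) == 0]%SET)%MS.
Proof.
move=> a0 [/cone_overP[c c0 ->] /=];
  rewrite -[dotr _ _]/(dot _ _) dot_sumr => e.
apply: summx_sub => G _; have [aG|aG] := eqVneq (dot a (pointR G)) 0.
  apply: scalemx_sub; have -> : pointR G = row (enum_rank G) (span_mx RR [set G
    : face_type Delta | dot a (pointR G) == 0]%SET).
    by rewrite rowK enum_rankK inE aG eqxx.
  exact: row_sub.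
have /psumr_eq0P/(_ G isT)/eqP : \sum_G dot a (c G *: pointR G) = 0 by [].
rewrite dotZr mulf_eq0 (negPf aG) orbF => h.
rewrite (eqP (h _)) ?scale0r ?sub0mx //.
by move=> H _; rewrite dotZr mulr_ge0.
Qed.

(** The rows of [M] selected by [maxrankfun] form a basis of its row space. *)
Lemma has_dim_rank m (X : set 'rV[RR]_n.+1) (M : 'M[RR]_(m, n.+1)) :
  (forall i, X (row i M)) -> (forall y, X y -> (y <= M)%MS) ->
    has_dim X (\rank M).
Proof.
move=> rX XM; exists (rowsub (maxrankfun M) M); split=> [|i|y /XM yM].
- exact: maxrowsub_free.
- by rewrite row_rowsub.
by rewrite eq_maxrowsub.
Qed.

Lemma has_dim_unique (X : set 'rV[RR]_n.+1) d d' : has_dim X d ->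
  has_dim X d' -> d = d'.
Proof.
move=> [M [/eqP rM MX XM]] [M' [/eqP rM' M'X XM']]; rewrite -rM -[RHS]rM'.
by apply/eqP; rewrite eqn_leq !mxrankS //; apply/row_subP => i;
  [exact: XM (M'X i)|exact: XM' (MX i)].
Qed.

Lemma cone_dim : has_dim C n.+1.
Proof.
suff : has_dim C (\rank (span_mx RR [set: face_type Delta]%SET)) by rewrite
  span_mx_full.
apply: has_dim_rank => [i|y _].
  by rewrite rowK inE; apply: cone_point.
by rewrite submx_full // /row_full span_mx_full.
Qed.

Lemma facet_of_form (a : 'rV[int]_n.+1) : facet_form Delta a ->
  facet C (facet_of (map_mx intr a)) /\ ~ facet_of (map_mx intr a) (delta_mx 0
    ord_max).
Proof.
move=> aF; have [a0 aP _ _] := aF.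
have aR (G : face_type Delta) :
  dot (map_mx intr a) (pointR G) = (dot a (point G))%:~R by rewrite dot_map.
have aR0 (G : face_type Delta) :
  0 <= dot (map_mx intr a) (pointR G) by rewrite aR ler0z.
have TE : [set G : face_type Delta | dot (map_mx intr a) (pointR G) == 0]%SET =
  vanishing Delta a.
  by apply/finset.setP => G; rewrite !inE aR intr_eq0.
split; last first.
  move=> [_ /=]; rewrite -[dotr _ _]/(dot _ _) dot_delta mxE => /eqP.
  by rewrite intr_eq0 gt_eqF.
split; first by exists (map_mx intr a) => // y /(cone_ge0 aR0).
exists n; first exact: cone_dim.
suff : has_dim (facet_of (map_mx intr a)) (\rank (span_mx RR (vanishing Delta
  a))).
  by rewrite rank_span_mx facet_form_rank.
apply: has_dim_rank => [i|y /(facet_of_span aR0)]; last by rewrite TE.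
rewrite rowK; case: ifP => [|_]; last first.
  split; last by rewrite /= -[dotr _ _]/(dot _ _) dot0r.
  by apply/cone_overP; exists (fun=> 0) => //; rewrite big1 // => G _;
    rewrite scale0r.
rewrite -TE inE => /eqP h; split; first exact: cone_point.
exact: h.
Qed.

(** The facet contains [n] independent lattice points, so the form defining it
    is unique up to scaling among those vanishing there; as these points are
    rational, so is a multiple of the form. *)
Lemma form_of_facet F : facet C F -> ~ F (delta_mx 0 ord_max) ->
  exists2 a : 'rV[int]_n.+1, facet_form Delta a & F = facet_of (map_mx intr a).
Proof.
move=> [[a a0 ->] [d dC dF]] nF.
have dn : d = n by apply/eq_add_S/(has_dim_unique dC cone_dim).
rewrite {}dn {dC} in dF.
have aP (G : face_type Delta) : 0 <= dot a (pointR G) by apply: a0;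
  apply: cone_point.
have am : 0 < a 0 ord_max.
  rewrite -(dot_point_empty Delta) lt_neqAle aP andbT eq_sym.
  apply/eqP => am; apply: nF; have eE :
    delta_mx 0 ord_max = pointR (face_empty Delta).
    by rewrite /point /lattice_point big_set0 add0r map_delta_mx.
  by rewrite eE; split; [exact: cone_point|exact: am].
have an0 : a != 0 by apply: contraTneq am => ->; rewrite mxE ltxx.
set T := [set G : face_type Delta | dot a (pointR G) == 0]%SET.
have aT : vanishes_on T a by move=> G; rewrite inE => /eqP.
have rT : \rank (span_mx RR T) = n.
  apply/eqP; rewrite eqn_leq; apply/andP; split.
    have := span_mx_kernel RR T.
    have : (0 < \rank (kermx (span_mx RR T)^T))%N.
      rewrite lt0n mxrank_eq0; apply: contraNneq an0 => k0.
      by have /vanishes_onP := aT; rewrite k0 submx0.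
    by have := rank_leq_col (span_mx RR T); lia.
  have [M [/eqP rM MF _]] := dF; rewrite -[leqLHS]rM; apply: mxrankS.
  by apply/row_subP => i; apply: facet_of_span => //; apply: MF.
have rQ : \rank (span_mx rat T) = n by rewrite -(rank_span_mx RR).
have [q q0 qT] : exists2 q : 'rV[rat]_n.+1, q != 0 & vanishes_on T q.
  have kn : kermx (span_mx rat T)^T != 0.
    by rewrite -mxrank_eq0 span_mx_kernel rQ subSnn.
  have [v vk v0] := rowV0Pn kn; exists v => //; exact/vanishes_onP.
(* Hence [q] is proportional to [a]; scale it to be positive on the cone. *)
have qR : vanishes_on T (map_mx ratr q : 'rV[RR]_n.+1).
  move=> G GT; have pE : pointR G = map_mx ratr (map_mx intr (point G)).
    by apply/rowP => i; rewrite !mxE rmorph_int.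
  by rewrite pE dot_map qT // rmorph0.
have [l qE] := (span_mx_hyperplane an0 aT).1 rT _ qR.
have l0 : l != 0.
  apply: contraNneq q0 => l0; move: qE; rewrite l0 scale0r => /rowP qz.
  by apply/eqP/rowP => i; have /eqP := qz i; rewrite !mxE fmorph_eq0 => /eqP.
have qm : q 0 ord_max != 0.
  have /rowP/(_ ord_max) := qE; rewrite !mxE => e.
  have : ratr (q 0 ord_max) != 0 :> RR by rewrite e mulf_neq0 // gt_eqF.
  by rewrite fmorph_eq0.
pose q' := (q 0 ord_max)^-1 *: q.
have q'R : a = a 0 ord_max *: map_mx ratr q'.
  have /rowP qE' := qE; have am0 : a 0 ord_max != 0 by rewrite gt_eqF.
  apply/rowP => i; have := qE' i; have := qE' ord_max; rewrite !mxE => em ei.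
  by rewrite rmorphM fmorphV /= em ei; field; rewrite am0 l0.
have pE (G : face_type Delta) :
  dot a (pointR G) = a 0 ord_max * ratr (dot q' (map_mx intr (point G))).
  have -> : pointR G = map_mx ratr (map_mx intr (point G)).
    by apply/rowP => i; rewrite !mxE rmorph_int.
  by rewrite {1}q'R dotZl dot_map.
have q'm : q' 0 ord_max = 1 by rewrite mxE mulVf.
have q'0 : q' != 0 by apply: contra_eq_neq q'm => ->;
  rewrite mxE eq_sym oner_eq0.
have q'T : vanishes_on T q'.
  by move=> G GT; rewrite dotZl qT // mulr0.
have [|G|b bT|b bF [k k0 q'b]] := @rational_facet_form n Delta q'.
- by rewrite q'm.
- by have := aP G; rewrite pE pmulr_rge0 // ler0q.
- apply: ((span_mx_hyperplane q'0 q'T).1 rQ) => G; rewrite inE pE => /eqP e;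
  apply: bT.
  by apply/eqP; move/eqP: e; rewrite mulf_eq0 gt_eqF //= fmorph_eq0.
exists b => //; rewrite /facet_of; congr (_ `&` _).
have ab : a = (a 0 ord_max * ratr k) *: map_mx intr b.
  rewrite {1}q'R q'b -scalerA; congr (_ *: _); apply/rowP => i.
  by rewrite !mxE rmorphM /= rmorph_int.
apply/seteqP; split=> y /=; rewrite -![dotr _ _]/(dot _ _) {1}ab dotZl.
  move/eqP; rewrite mulf_eq0 mulf_eq0 gt_eqF // fmorph_eq0 gt_eqF //= => /eqP//.
by move=> ->; rewrite mulr0.
Qed.

Lemma facet_of_inj (a b : 'rV[int]_n.+1) : facet_form Delta a ->
  facet_form Delta b ->
  facet_of (map_mx intr a) = facet_of (map_mx intr b) -> a = b.
Proof.
move=> aF bF ab; apply: (facet_form_inj aF bF); apply/fintype.subsetP => G.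
rewrite !inE => /eqP aG; have : facet_of (map_mx intr a) (pointR G).
  by split; [exact: cone_point|rewrite /= -[dotr _ _]/(dot _ _) dot_map aG].
by rewrite ab => -[_ /=]; rewrite -[dotr _ _]/(dot _ _) dot_map => /eqP;
  rewrite intr_eq0.
Qed.

End RealFacets.

Local Open Scope card_scope.

Theorem corollary1p8 (RR : realType) (K : fieldType) (n : nat)
    (Delta : simplicial_complex n) :
  normal_domain (toric_ring K Delta) ->
  exists r : nat,
    [/\ (0 < r)%N,
        minimal_primes (principal_ideal (toric_t K Delta)) #= `I_r,
        [set F : set 'rV[RR]_n.+1 |
          facet (cone_over RR (toric_semigroup Delta)) F /\
          ~ F (delta_mx 0 ord_max)] #= `I_r &
        free_of_rank (class_group (toric_ring K Delta)) r.-1].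
Proof.
move=> /normal_saturated satS.
have [r [L [LF Linj Lsurj]]] := enum_facet_forms Delta.
have [a aF am] := unit_facet_form Delta; have [j0 aj0] := Lsurj a aF.
case: r L LF Linj Lsurj j0 aj0 => [|r] L LF Linj Lsurj j0 aj0;
  first by case: j0 {aj0}.
exists r.+1; split=> //.
- rewrite (facet_minimal_primes K satS LF Lsurj); apply: card_eq_range.
  exact: facet_prime_inj.
- rewrite (_ : [set F | _] = [set facet_of Delta (map_mx intr (L j)) | j in
  [set: 'I_r.+1]]).
    by apply: card_eq_range => i j /(facet_of_inj (LF i) (LF j))/Linj.
  apply/seteqP; split=> [F [FC Fe]|_ [j _ <-]]; last exact: facet_of_form.
  by have [b /Lsurj[j ->] ->] := form_of_facet FC Fe; exists j.
- by apply: (class_group_free K satS LF Linj Lsurj (j0 := j0)); rewrite -aj0.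
Qed.
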